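(* For every odd integer $n \ge 5$ there exists a fully resolvable CMDRR$(3n, n)$.
   Context: A mixed doubles game is a match between two teams, each team consisting of one man and one woman; in a game $M_a F_b$ v $M_c F_d$, $M_a$ and $F_b$ are partners, $M_c$ and $F_d$ are partners, and each player of one team opposes each player of the other team. A complete mixed doubles round robin tournament CMDRR$(N,k)$ is a schedule (set) of mixed doubles games for $N$ men and $N$ women, of which $k$ men and $k$ women are paired into $k$ spouse pairs (a spouse pair is one man and one woman), such that: spouses never play in a game together as partners or opponents; every man and woman who are not spouses are partners exactly once and opponents exactly once; each player who has a spouse opposes every other player of the same sex exactly once; each player who does not have a spouse opposes some other same-sex player who does not have a spouse exactly twice and opposes all other same-sex players exactly once. The games are to be partitioned into rounds, each player playing in at most one game per round. A round is full if it involves all $2N$ players when $N$ is even, or all but 2 players when $N$ is odd; otherwise it is short. The CMDRR is fully resolvable if its games can be partitioned into rounds with at most one short round. *)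

(* Defs.v *)
From mathcomp Require Import all_boot.
Set Implicit Arguments. Unset Strict Implicit. Unset Printing Implicit Defensive.

(* Players: men 'I_N and women 'I_N.
   A game M_a F_b v M_c F_d is the quadruple (((a, b), c), d). *)
Definition game (N : nat) := ('I_N * 'I_N * 'I_N * 'I_N)%type.

Section CMDRR.
Variable N : nat.
Implicit Types (g : game N) (G R : seq (game N)) (m w : 'I_N).

Definition gm1 g : 'I_N := g.1.1.1.
Definition gw1 g : 'I_N := g.1.1.2.
Definition gm2 g : 'I_N := g.1.2.
Definition gw2 g : 'I_N := g.2.

Definition valid_game g : bool := (gm1 g != gm2 g) && (gw1 g != gw2 g).

Definition spouse_matching (S : {set 'I_N * 'I_N}) : Prop :=
  forall p q, p \in S -> q \in S -> (p.1 = q.1 \/ p.2 = q.2) -> p = q.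

Definition has_spouse_man (S : {set 'I_N * 'I_N}) m : bool :=
  [exists w, (m, w) \in S].
Definition has_spouse_woman (S : {set 'I_N * 'I_N}) w : bool :=
  [exists m, (m, w) \in S].

Definition partner_count G m w : nat :=
  count (fun g => ((gm1 g == m) && (gw1 g == w)) || ((gm2 g == m) && (gw2 g == w))) G.
Definition opp_mw_count G m w : nat :=
  count (fun g => ((gm1 g == m) && (gw2 g == w)) || ((gm2 g == m) && (gw1 g == w))) G.
Definition opp_men_count G m m' : nat :=
  count (fun g => ((gm1 g == m) && (gm2 g == m')) || ((gm1 g == m') && (gm2 g == m))) G.
Definition opp_women_count G w w' : nat :=
  count (fun g => ((gw1 g == w) && (gw2 g == w')) || ((gw1 g == w') && (gw2 g == w))) G.

Definition is_CMDRR (k : nat) (S : {set 'I_N * 'I_N}) G : Prop :=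
  [/\ spouse_matching S /\ #|S| = k /\ all valid_game G,
      (forall g m w, g \in G -> (m, w) \in S ->
          ~ ((m \in [:: gm1 g; gm2 g]) /\ (w \in [:: gw1 g; gw2 g]))),
      (forall m w, (m, w) \notin S ->
          partner_count G m w = 1 /\ opp_mw_count G m w = 1),
      ((forall m, has_spouse_man S m ->
          forall m', m' != m -> opp_men_count G m m' = 1) /\
       (forall w, has_spouse_woman S w ->
          forall w', w' != w -> opp_women_count G w w' = 1)) &
      ((forall m, ~~ has_spouse_man S m ->
          exists m', [/\ m' != m, ~~ has_spouse_man S m',
                        opp_men_count G m m' = 2 &
                        forall m'', m'' != m -> m'' != m' ->
                          opp_men_count G m m'' = 1]) /\
       (forall w, ~~ has_spouse_woman S w ->
          exists w', [/\ w' != w, ~~ has_spouse_woman S w',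
                        opp_women_count G w w' = 2 &
                        forall w'', w'' != w -> w'' != w' ->
                          opp_women_count G w w'' = 1]))].

Definition round_men R : seq 'I_N := flatten [seq [:: gm1 g; gm2 g] | g <- R].
Definition round_women R : seq 'I_N := flatten [seq [:: gw1 g; gw2 g] | g <- R].

Definition valid_round R : bool := uniq (round_men R) && uniq (round_women R).

Definition players_in_round R : nat :=
  #|[set m | m \in round_men R]| + #|[set w | w \in round_women R]|.

Definition full_round R : bool :=
  players_in_round R == (if odd N then (2 * N - 2)%N else (2 * N)%N).

Definition fully_resolvable G : Prop :=
  exists rounds : seq (seq (game N)),
    [/\ perm_eq (flatten rounds) G, all valid_round rounds &
        count (fun R => ~~ full_round R) rounds <= 1].

End CMDRR.

(* Main.v *)
(* Idea.  Write FR(N, k) for a fully resolvable CMDRR(N, k).  The schedule is built from a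
   starter: a set of games in an abelian group G with a subgroup H, whose points and whose
   partner and opponent differences each cover every element outside H once.  Replace every
   player of the translated starter games by t players according to a transversal design
   with five columns (two men, two women and the round): two players then meet as they
   should exactly if they lie in different cosets of H.  Transversal designs with a hole of
   size x adjoin 2x further "infinite" players for every game of the starter.  If
   t |H| = 3m, complete each coset together with three fixed infinite players by
   FR(3m + 3, m + 1) minus one FR(3, 1), and the infinite players, 3n' of them, by
   FR(3n', n'): this gives FR(3n, n) for n = m |G/H| + n'.  The games (d, 2d, -d, -2d) in
   Z_q, q prime to 6, with t = 12, deal with all n >= 265 by induction; twelve starters with
   |H| = 3, and t = 1, 4, 8, do the rest. *)
Require Import Defs.
From HB Require Import structures.
From mathcomp Require Import all_boot.
From mathcomp Require Import ssralg finalg zmodp zify.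
From Stdlib Require Import Lia.
Set Implicit Arguments. Unset Strict Implicit. Unset Printing Implicit Defensive.
Import GRing.Theory.

(** * Designs with a core *)

(** A CMDRR$(3n, n)$ has n(9n - 1)/2 games: 3n full rounds of (3n - 1)/2 games each, and n games
    left over. So the full rounds can be labelled by the 3n player indices, and the round can be a
    column of the transversal design just like the four players. An infinite symbol in a player
    column replaces players on one side of one starter game, so it stands for two new players, one
    per side. As a round symbol it collects games in which every finite player occurs twice; the two
    halves separate these into the two rounds labelled by those two new players. Infinite players
    thus arise in pairs, whereas 3n' is odd. The three fixed ones repair the parity; they form a
    core common to all cosets. The designs with a core of size 3 come from the starters themselves:
    for n = 5 and n = 9, filling all cosets but one gives 15 and 27 players with an open FR(3, 1).
    Only FR(3, 1) is written by hand. FR(9, 3) is not constructed, so n' = 3 is avoided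
    throughout. *)

Definition quad (T : Type) := (T * T * T * T)%type.

(* [s] tells men from women; equal [sg]s are partners. *)
Definition pos (T : Type) (g : quad T) (s sg : bool) : T :=
  if s then (if sg then g.1.1.1 else g.1.2)
  else (if sg then g.1.1.2 else g.2).

Definition qmap (T U : Type) (f : T -> U) (g : quad T) : quad U :=
  (f g.1.1.1, f g.1.1.2, f g.1.2, f g.2).

Lemma pos_qmap (T U : Type) (f : T -> U) g s sg :
  pos (qmap f g) s sg = f (pos g s sg).
Proof. by case: s sg => [] []. Qed.

(** Coding a relation by two sexes and a flag for crossing the net lets all four conditions be
    proved at once, both for differences in a starter and for meetings in a schedule. *)
Inductive relk := PartnerMW | OppMW | OppMM | OppWW.
Definition rel_fst r := if r is OppWW then false else true.
Definition rel_snd r := if r is OppMM then true else false.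
Definition rel_cross r := if r is PartnerMW then false else true.
Definition same_sex r := rel_fst r == rel_snd r.

Section Indicators.
Variable T : eqType.
Definition ind r (x y : T) (g : quad T) : nat :=
  \sum_(sg : bool) ((pos g (rel_fst r) sg == x) &&
                    (pos g (rel_snd r) (sg (+) rel_cross r) == y)).
Definition ind1 s (x : T) (g : quad T) : nat := \sum_(sg : bool) (pos g s sg == x).
End Indicators.

Section Indmap.
Variables (T U : eqType) (f : T -> U).
Hypothesis finj : injective f.
Lemma ind_qmap r x y g : ind r (f x) (f y) (qmap f g) = ind r x y g.
Proof. by apply: eq_bigr => sg _; rewrite !pos_qmap !(inj_eq finj). Qed.
Lemma ind1_qmap s x g : ind1 s (f x) (qmap f g) = ind1 s x g.
Proof. by apply: eq_bigr => sg _; rewrite !pos_qmap !(inj_eq finj). Qed.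
Lemma ind_qmap0l r z y g : (forall x, f x != z) -> ind r z y (qmap f g) = 0.
Proof. by move=> nz; apply: big1 => sg _; rewrite pos_qmap (negbTE (nz _)). Qed.
Lemma ind_qmap0r r z y g : (forall x, f x != z) -> ind r y z (qmap f g) = 0.
Proof.
by move=> nz; apply: big1 => sg _; rewrite !pos_qmap (negbTE (nz _)) andbF.
Qed.
Lemma ind1_qmap0 s z g : (forall x, f x != z) -> ind1 s z (qmap f g) = 0.
Proof. by move=> nz; apply: big1 => sg _; rewrite pos_qmap (negbTE (nz _)). Qed.
End Indmap.

Section Design.
Variable T : finType.
Definition tot (F : quad T -> nat) (R : T -> seq (quad T)) (Z : seq (quad T)) :=
  \sum_r \sum_(g <- R r) F g + \sum_(g <- Z) F g.

Definition target (A : {set T}) (dl : bool -> T -> T) r (x y : T) : nat :=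
  if same_sex r then (x != y) * (1 + (dl (rel_fst r) x == y))
  else ~~ ((x == y) && (x \in A)).

(* A schedule with one round [R r] for every player [r] and a short round [Z], with a hole
   on the core [C]: no two core players meet, the rounds indexed by core players involve
   exactly the other players, and the short round avoids the core.  The spouse pairs are
   the [(x, x)] with [x] in [A]; [dl s x] is the player whom [x] outside [A] opposes twice.
   Core players are counted in [A], and [C := set0] gives a fully resolvable CMDRR. *)
Record ifr (C A : {set T}) (dl : bool -> T -> T)
    (R : T -> seq (quad T)) (Z : seq (quad T)) : Prop := Ifr {
  ifr_core : C \subset A;
  ifr_inv : forall s, involutive (dl s);
  ifr_fix : forall s x, (dl s x == x) = (x \in A);
  ifr_rel : forall r x y, tot (ind r x y) R Z =
    if (x \in C) && (y \in C) then 0 else target A dl r x y;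
  ifr_round : forall s r, r \notin C -> exists b, forall x,
    \sum_(g <- R r) ind1 s x g = (x != b);
  ifr_round_core : forall s r x, r \in C -> \sum_(g <- R r) ind1 s x g = (x \notin C);
  ifr_short : forall s x, \sum_(g <- Z) ind1 s x g <= (x \notin C) }.
End Design.

(** The universal form allows an ingredient to be placed on any coset with any prescribed core; by
    [IFR_intro] a single instance suffices. *)
Definition IFR N w k := forall (T : finType) (C : {set T}), #|T| = N -> #|C| = w ->
  exists (A : {set T}) dl R Z, ifr C A dl R Z /\ #|A| = k.

(** The enumerations of the core and of its complement are matched separately. *)
Lemma bij_imset (T U : finType) (C : {set T}) (D : {set U}) :
  #|T| = #|U| -> #|C| = #|D| -> exists2 f : T -> U, bijective f & f @: C = D.
Proof.
move=> eqTU eqCD.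
have eqC : #|~: C| = #|~: D| by apply: (@addnI #|C|); rewrite {2}eqCD !cardsC.
have memC x : ~ x \in C -> x \in ~: C by move/negP; rewrite inE.
pose f x := match @idP (x \in C) with
  | ReflectT h => enum_val (cast_ord eqCD (enum_rank_in h x))
  | ReflectF h => enum_val (cast_ord eqC (enum_rank_in (memC x h) x)) end.
have fD x : (f x \in D) = (x \in C).
  rewrite /f; case: {-}_ / idP => h.
    by rewrite h; apply: enum_valP.
  have := enum_valP (cast_ord eqC (enum_rank_in (memC x h) x)).
  by rewrite inE => /negbTE->; apply/esym/negbTE/negP.
have finj : injective f.
  move=> x y fxy; have := fD x; rewrite fxy fD; move: fxy; rewrite /f.
  case: {-}_ / idP => hx; case: {-}_ / idP => hy.
  - by move=> /enum_val_inj/cast_ord_inj exy _; rewrite -(enum_rankK_in hx hx) exy enum_rankK_in.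
  - by move=> _ /esym yx; case: hy; rewrite -yx.
  - by move=> _ yx; case: hx; rewrite -yx.
  move=> /enum_val_inj/cast_ord_inj exy _.
  by rewrite -(enum_rankK_in (memC x hx) (memC x hx)) exy enum_rankK_in ?memC.
exists f; first by apply: inj_card_bij; rewrite ?eqTU.
apply/eqP; rewrite eqEcard card_imset // eqCD leqnn andbT.
by apply/subsetP => _ /imsetP[x xC ->]; rewrite fD.
Qed.

Section Transport.
Variables (T U : finType) (f : T -> U).
Lemma ifr_transport (fbij : bijective f) C A dl R Z :
  ifr C A dl R Z ->
  exists dl' R' Z', ifr (f @: C) (f @: A) dl' R' Z'.
Proof.
case: fbij => f' fK f'K [Hcore Hinv Hfix Hrel Hround Hroundc Hshort].
have finj : injective f := can_inj fK.
have memA (B : {set T}) y : (y \in f @: B) = (f' y \in B).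
  by rewrite -{1}[y]f'K mem_imset.
pose qm := map (qmap f).
have sumF (s : seq (quad T)) F : \sum_(g <- qm s) F g = \sum_(g <- s) F (qmap f g).
  by rewrite big_map.
have sum1F (s : seq (quad T)) sx x :
    \sum_(g <- qm s) ind1 sx x g = \sum_(g <- s) ind1 sx (f' x) g.
  by rewrite sumF; apply: eq_bigr => g _; rewrite -{1}[x]f'K ind1_qmap.
exists (fun s y => f (dl s (f' y))), (fun y => qm (R (f' y))), (qm Z); split.
- by apply/subsetP => y; rewrite !memA; apply: (subsetP Hcore).
- by move=> s y; rewrite fK Hinv f'K.
- move=> s y; rewrite memA -(Hfix s).
  by apply/eqP/eqP => [{2}<-|->]; rewrite ?fK ?f'K.
- move=> r x y; rewrite -[x]f'K -[y]f'K.
  transitivity (if (f' x \in C) && (f' y \in C) then 0 else target A dl r (f' x) (f' y)).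
    rewrite -Hrel /tot; congr (_ + _).
      rewrite (reindex_onto f f') /=; last by move=> z _; rewrite f'K.
      rewrite (eq_bigl xpredT) => [|z]; last by rewrite fK eqxx.
      apply: eq_bigr => z _; rewrite sumF fK.
      by apply: eq_bigr => g _; rewrite ind_qmap.
    by rewrite sumF; apply: eq_bigr => g _; rewrite ind_qmap.
  by rewrite /target !memA !(inj_eq finj) !fK.
- move=> s r; rewrite memA => /(Hround s)[b Hb]; exists (f b) => x.
  by rewrite sum1F Hb -(inj_eq finj) f'K.
- by move=> s r x; rewrite !memA sum1F => rC; rewrite Hroundc.
- by move=> s x; rewrite memA sum1F.
Qed.
End Transport.

Lemma IFR_intro (T : finType) (C A : {set T}) dl R Z :
  ifr C A dl R Z -> IFR #|T| #|C| #|A|.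
Proof.
move=> D U C' cU cC.
have [f fbij <-] := bij_imset (esym cU) (esym cC).
have [dl' [R' [Z' D']]] := ifr_transport fbij D.
exists (f @: A), dl', R', Z'; split=> //.
by rewrite card_imset //; apply: bij_inj.
Qed.

(** * Filling the holes of a frame *)

(* Transversal designs on the finite symbols [inl a] with a hole on the infinite symbols
   [inr l], [l < x].  The columns of a row are two men, two women and the round [rsym];
   the rows with an infinite round split into two halves, each of which contains every
   finite type once among the men and once among the women. *)
Section ITD.
Variable A : finType.
Definition symbol := (A + nat)%type.
Definition is_inf (s : symbol) := if s is inr _ then true else false.
Definition valid_sym x (s : symbol) := if s is inr l then l < x else true.

Definition row := (quad symbol * symbol * bool)%type.
Definition rsym (p : row) := p.1.2.
Definition rhalf (p : row) := p.2.

Record itd x (L : seq row) : Prop := Itd {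
  itd_valid : forall p, p \in L ->
    (forall s sg, valid_sym x (pos p.1.1 s sg)) /\ valid_sym x (rsym p);
  itd_pair : forall s sg s' sg' u v, (s, sg) != (s', sg') ->
    valid_sym x u -> valid_sym x v ->
    \sum_(p <- L) ((pos p.1.1 s sg == u) && (pos p.1.1 s' sg' == v)) =
      ~~ (is_inf u && is_inf v);
  itd_round : forall s sg u v, valid_sym x u -> valid_sym x v ->
    \sum_(p <- L) ((pos p.1.1 s sg == u) && (rsym p == v)) =
      ~~ (is_inf u && is_inf v);
  itd_half : forall s h l a, l < x ->
    \sum_(p <- L | (rsym p == inr l) && (rhalf p == h))
      ind1 s (inl a) p.1.1 = 1 }.
End ITD.

(* [pr] is the quotient of [G] by the hole subgroup; [hd] and [mk] identify every coset
   with [H], which is only a set, so that the extension need not split. *)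
Record cosets (G V : finZmodType) (H : finType) (pr : G -> V) (hd : G -> H)
    (mk : H -> V -> G) : Prop := Cosets {
  pr_sub : {morph pr : y z / (y - z)%R};
  pr_mk : forall h v, pr (mk h v) = v;
  hd_mk : forall h v, hd (mk h v) = h;
  mk_hd : forall y, mk (hd y) (pr y) = y }.

Record starter (G V : finZmodType) (pr : G -> V) (I : finType) (base : I -> quad G) : Prop :=
  Starter {
  starter_point : forall s y,
    \sum_b \sum_(sg : bool) (pos (base b) s sg == y) = (pr y != 0%R);
  starter_diff : forall r y,
    \sum_b \sum_(sg : bool)
      ((pos (base b) (rel_snd r) (sg (+) rel_cross r) - pos (base b) (rel_fst r) sg)%R == y)
    = (pr y != 0%R) }.

Section Frame.
Variables (G V : finZmodType) (H : finType) (pr : G -> V) (hd : G -> H) (mk : H -> V -> G).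
Variables (I : finType) (base : I -> quad G) (A W : finType) (x : I -> nat).
Variable rows : I -> seq (row A).
Hypothesis prP : cosets pr hd mk.
Hypothesis baseP : starter pr base.
Hypothesis rowsP : forall b, itd (x b) (rows b).

(* The infinite player [((b, sg), l)] replaces the players in position [sg] of the
   translates of the game [base b]. *)
Notation infinite := {e : I * bool & 'I_(x e.1)}.
Notation S := (W + infinite)%type.
Notation player := (A * G + S)%type.
Variable p0 : player.

(** The default [p0] is not reached from symbols satisfying [valid_sym], the only ones in the rows
    of a design. *)
Definition inf_player (e : I * bool) (l : nat) : player :=
  if insub l is Some o then inr (inr (Tagged (fun e => 'I_(x e.1)) (o : 'I_(x e.1)))) else p0.

Definition place s sg (c : G) b (u : symbol A) : player :=
  match u with
  | inl a => inl (a, (c + pos (base b) s sg)%R)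
  | inr l => inf_player (b, sg) l
  end.

(** For players of [W] the value is conventional: [hit] is false for them, which annihilates every
    count in which [sym] enters. *)
Definition sym (p : player) : symbol A :=
  match p with
  | inl ay => inl ay.1
  | inr (inl _) => inr 0
  | inr (inr t) => inr (val (tagged t))
  end.

Definition hit s sg c b (p : player) : bool :=
  match p with
  | inl ay => (c + pos (base b) s sg == ay.2)%R
  | inr (inl _) => false
  | inr (inr t) => tag t == (b, sg)
  end.

(** This separates the group coordinate ([hit]) from the design coordinate ([sym]), so that meetings
    factor into a count over the starter and a count over the rows. *)
Lemma place_hit s sg c b u p : valid_sym (x b) u ->
  (place s sg c b u == p) = hit s sg c b p && (u == sym p).
Proof.
case: u => [a|l] /= vl.
  case: p => [[a' y]|[w|t]] //=; last by rewrite andbF.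
  by rewrite andbC; apply/eqP/andP => [[-> ->]|[/eqP[->] /eqP->]]; rewrite ?eqxx.
rewrite /inf_player insubT.
case: p => [[a' y]|[w|t]] //=; first by rewrite andbF.
case: t => [e o] /=; apply/eqP/andP => [teq|[/eqP e1]]; last first.
  by subst e => /eqP[lo]; congr (inr (inr (Tagged _ _))); apply: val_inj.
have := congr1 (fun p : player => if p is inr (inr t)
  then ((b, sg) == tag t) && (l == val (tagged t)) else false) teq.
by rewrite /= !eqxx eq_sym => /esym/andP[-> /eqP<-].
Qed.

Lemma hit_valid s sg c b p : hit s sg c b p -> valid_sym (x b) (sym p).
Proof. by case: p => [//|[//|[e o]]] /= /eqP ee; move: o; rewrite ee => o /=. Qed.

Definition bgame c b (p : row A) : quad player :=
  (place true true c b (pos p.1.1 true true), place false true c b (pos p.1.1 false true),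
   place true false c b (pos p.1.1 true false), place false false c b (pos p.1.1 false false)).

Lemma pos_bgame c b p s sg :
  pos (bgame c b p) s sg = place s sg c b (pos p.1.1 s sg).
Proof. by case: s sg => [] []. Qed.

Lemma sum_row c b s sg p (Q : row A -> bool) :
  \sum_(q <- rows b | Q q) (pos (bgame c b q) s sg == p) =
  hit s sg c b p * \sum_(q <- rows b | Q q) (pos q.1.1 s sg == sym p).
Proof.
rewrite big_distrr /= big_seq_cond [RHS]big_seq_cond.
apply: eq_bigr => q /andP[qL _].
have [vq _] := itd_valid (rowsP b) qL.
by rewrite pos_bgame place_hit // mulnb.
Qed.

Lemma sum_row_round c b s sg p v : valid_sym (x b) v ->
  \sum_(q <- rows b | rsym q == v) (pos (bgame c b q) s sg == p) =
  hit s sg c b p * ~~ (is_inf (sym p) && is_inf v).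
Proof.
move=> vv; rewrite sum_row; case: (boolP (hit _ _ _ _ _)) => [/hit_valid vp|//].
rewrite !mul1n -(itd_round (rowsP b) s sg vp vv) big_mkcond.
by apply: eq_bigr => q _; case: eqP; rewrite ?andbT ?andbF.
Qed.

Lemma sum_row_pair c b s sg s' sg' p p' : (s, sg) != (s', sg') ->
  \sum_(q <- rows b)
     ((pos (bgame c b q) s sg == p) && (pos (bgame c b q) s' sg' == p')) =
  hit s sg c b p && hit s' sg' c b p' && ~~ (is_inf (sym p) && is_inf (sym p')).
Proof.
move=> ne.
have E q : q \in rows b ->
   ((pos (bgame c b q) s sg == p) && (pos (bgame c b q) s' sg' == p')) =
   (hit s sg c b p && hit s' sg' c b p') &&
   ((pos q.1.1 s sg == sym p) && (pos q.1.1 s' sg' == sym p')) :> bool.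
  move=> qL; have [vq _] := itd_valid (rowsP b) qL.
  by rewrite !pos_bgame !place_hit // andbACA.
under eq_big_seq => q qL do rewrite E // -mulnb.
rewrite -big_distrr /=.
case: (boolP (_ && _)) => [/andP[/hit_valid vp /hit_valid vp']|//].
by rewrite (itd_pair (rowsP b)) // mul1n.
Qed.

Lemma sum_inj1 (T U : finType) (h : T -> U) b (hinj : injective h) (cTU : #|T| = #|U|) :
  \sum_(a : T) (h a == b) = 1.
Proof.
have [h' hK h'K] := inj_card_bij hinj (eq_leq (esym cTU)).
rewrite (eq_bigr (fun a => (a == h' b) : nat)) => [|a _].
  by rewrite -big_mkcond big_pred1_eq.
by rewrite -{1}[b]h'K (inj_eq hinj).
Qed.

Lemma sum_center (u y : G) : \sum_(c : G) (c + u == y)%R = 1.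
Proof. by apply: sum_inj1 => // v w /addIr. Qed.

Lemma sum_row_split b (F : row A -> nat) :
  \sum_(q <- rows b) F q =
  \sum_(k : A) \sum_(q <- rows b | rsym q == inl k) F q +
  \sum_(l < x b) \sum_(h : bool)
     \sum_(q <- rows b | (rsym q == inr (val l)) && (rhalf q == h)) F q.
Proof.
have E1 q : q \in rows b -> \sum_(k : A) (rsym q == inl k) +
     \sum_(l < x b) (rsym q == inr (val l)) = 1.
  move=> qL; have [_ vq] := itd_valid (rowsP b) qL.
  case: (rsym q) vq => [a|l] /= vl.
    rewrite [X in _ + X]big1 // addn0 -[RHS](sum_inj1 a (h := id)) //.
    by apply: eq_bigr => k _; congr nat_of_bool; apply/eqP/eqP => [[->]|->].
  rewrite big1 // add0n -[RHS](sum_inj1 (Ordinal vl) (h := id)) //.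
  by apply: eq_bigr => k _; congr nat_of_bool; apply/eqP/eqP => [[e]|->] //; apply: val_inj.
rewrite (eq_bigr (fun l : 'I_(x b) => \sum_(q <- rows b | rsym q == inr (val l)) F q)).
  under [X in X + _]eq_bigr => k _ do rewrite big_mkcond.
  under [X in _ + X]eq_bigr => k _ do rewrite big_mkcond.
  rewrite exchange_big /= [X in _ + X]exchange_big /= -big_split /=.
  apply: eq_big_seq => q qL; rewrite -[LHS]muln1 -(E1 q qL) mulnDr !big_distrr /=.
  by congr (_ + _); apply: eq_bigr => k _; case: eqP; rewrite ?muln1 ?muln0.
move=> l _; rewrite (partition_big (@rhalf A) xpredT) //=.
Qed.

Lemma sum_infinite (F : I * bool -> nat -> nat) :
  \sum_(t : infinite) F (tag t) (val (tagged t)) = \sum_e \sum_(l < x e.1) F e l.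
Proof.
by rewrite (sig_big_dep xpredT (fun _ => xpredT) (fun e (l : 'I_(x e.1)) => F e l)).
Qed.

(* how often two players are in any given relation in the translated starter games *)
Definition T_target (p p' : player) : nat :=
  match p, p' with
  | inl ay, inl bz => pr ay.2 != pr bz.2
  | inl _, inr (inr _) | inr (inr _), inl _ => 1
  | _, _ => 0
  end.

Lemma sum_tag (t : infinite) (f : bool -> bool) : injective f ->
  \sum_(b : I) \sum_(sg : bool) (tag t == (b, f sg)) = 1.
Proof.
move=> finj; rewrite pair_big /= -[RHS](sum_inj1 (tag t) (h := fun e => (e.1, f e.2))) //.
  by apply: eq_bigr => -[b sg] _; rewrite eq_sym.
by move=> [b sg] [b' sg'] /= [-> /finj ->].
Qed.

(** For finite players, the starter gives one [(b, sg)] with the required difference exactly when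
    the cosets differ, and one player then fixes the center [c]. An infinite player fixes [(b, sg)]
    by its tag, and a finite partner or opponent fixes [c]. Two infinite players are kept apart by
    the hole of the transversal design. *)
Lemma T_rel r p p' :
  \sum_(c : G) \sum_b \sum_(q <- rows b) ind r p p' (bgame c b q) =
  T_target p p'.
Proof.
transitivity (\sum_b \sum_(sg : bool) \sum_(c : G)
   (hit (rel_fst r) sg c b p && hit (rel_snd r) (sg (+) rel_cross r) c b p' &&
     ~~ (is_inf (sym p) && is_inf (sym p')))).
  rewrite exchange_big /=; apply: eq_bigr => b _.
  rewrite [RHS]exchange_big /=; apply: eq_bigr => c _.
  rewrite exchange_big /=; apply: eq_bigr => sg _.
  by rewrite sum_row_pair //; case: (r) sg => [] [].
case: p p' => [[a y]|[w|t]] [[b z]|[w'|t']] /=.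
- transitivity (pr (z - y)%R != 0%R : nat); last by rewrite (pr_sub prP) subr_eq0 eq_sym.
  rewrite -(starter_diff baseP r); apply: eq_bigr => e _; apply: eq_bigr => sg _.
  rewrite -[RHS]muln1 -(sum_center (pos (base e) (rel_fst r) sg) y) big_distrr /=.
  apply: eq_bigr => c _; rewrite andbT mulnb [in RHS]andbC; congr nat_of_bool.
  case: eqP => [<-|//] /=.
  rewrite [RHS]eq_sym subr_eq [(c + pos _ (rel_fst r) _)%R]addrC addrA subrK.
  by rewrite [(pos _ _ _ + c)%R]addrC eq_sym.
- by rewrite big1 // => e _; rewrite big1 // => sg _; rewrite big1 // => c _; rewrite andbF.
- rewrite -[RHS](sum_tag t' (f := fun sg => sg (+) rel_cross r)); last first.
    exact: addIb.
  apply: eq_bigr => e _; apply: eq_bigr => sg _.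
  rewrite -[RHS]mul1n -(sum_center (pos (base e) (rel_fst r) sg) y).
  by rewrite big_distrl /=; apply: eq_bigr => c _; rewrite andbT mulnb.
- by rewrite big1 // => e _; rewrite big1 // => sg _; rewrite big1.
- by rewrite big1 // => e _; rewrite big1 // => sg _; rewrite big1.
- by rewrite big1 // => e _; rewrite big1 // => sg _; rewrite big1.
- rewrite -[RHS](sum_tag t (f := id)) //.
  apply: eq_bigr => e _; apply: eq_bigr => sg _.
  rewrite -[RHS]muln1 -(sum_center (pos (base e) (rel_snd r) (sg (+) rel_cross r)) z).
  by rewrite big_distrr /=; apply: eq_bigr => c _; rewrite andbT mulnb.
- by rewrite big1 // => e _; rewrite big1 // => sg _; rewrite big1 // => c _; rewrite andbF.
- by rewrite big1 // => e _; rewrite big1 // => sg _; rewrite big1 // => c _; rewrite andbF.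
Qed.

(** A finite player at y is hit from center [c] when y - c is a starter point, which fails exactly
    on the coset of [c]; an infinite player occurs only at its own [(b, sg)]. *)
Lemma T_round k c s p :
  \sum_b \sum_(q <- rows b | rsym q == inl k) ind1 s p (bgame c b q) =
  match p with inl ay => pr ay.2 != pr c | inr (inl _) => false | inr (inr _) => true end.
Proof.
transitivity (\sum_b \sum_(sg : bool) hit s sg c b p).
  apply: eq_bigr => b _; rewrite exchange_big /=.
  by apply: eq_bigr => sg _; rewrite sum_row_round // andbF muln1.
case: p => [[a y]|[w|t]] /=; last by rewrite (sum_tag t (f := id)).
  transitivity (pr (y - c)%R != 0%R : nat); last by rewrite (pr_sub prP) subr_eq0.
  rewrite -(starter_point baseP s); apply: eq_bigr => b _; apply: eq_bigr => sg _.
  by congr nat_of_bool; rewrite eq_sym [RHS]eq_sym subr_eq addrC.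
by rewrite big1 // => b _; rewrite big1.
Qed.

(** A half holds each finite type once per sex, in some position, and exactly one translate moves
    that position to a given group element. Infinite players are absent because no row has an
    infinite player together with an infinite round. *)
Lemma T_inf_round b l h s p : l < x b ->
  \sum_(c : G) \sum_(q <- rows b | (rsym q == inr l) && (rhalf q == h))
     ind1 s p (bgame c b q) =
  if p is inl _ then 1 else 0.
Proof.
move=> lb.
case: p => [[a y]|t].
  transitivity (\sum_(sg : bool) \sum_(q <- rows b | (rsym q == inr l) && (rhalf q == h))
     (pos q.1.1 s sg == inl a)).
    under eq_bigr => c _ do rewrite exchange_big /=.
    rewrite exchange_big /=; apply: eq_bigr => sg _.
    under eq_bigr => c _ do rewrite sum_row //=.
    by rewrite -big_distrl /= sum_center mul1n.
  by rewrite exchange_big /= (itd_half (rowsP b)).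
rewrite big1 // => c _; apply/eqP; rewrite -leqn0.
apply: (@leq_trans (\sum_(q <- rows b | rsym q == inr l) ind1 s (inr t) (bgame c b q))).
  rewrite [leqLHS]big_mkcondr /=; apply: leq_sum => q _.
  by case: ifP.
rewrite exchange_big /= big1 // => sg _; rewrite sum_row_round //.
by case: t => [w|t] //=; rewrite muln0.
Qed.

(** * The completed schedule: translated games, holes and infinite players *)

Notation U := ((A * H) + W)%type.
Variables (CH AH : V -> {set U}) (dlH : V -> bool -> U -> U).
Variables (RH : V -> U -> seq (quad U)) (ZH : V -> seq (quad U)).
Variables (CS AS : {set S}) (dlS : bool -> S -> S) (RS : S -> seq (quad S)) (ZS : seq (quad S)).
Hypothesis holeP : forall v, ifr (CH v) (AH v) (dlH v) (RH v) (ZH v).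
Hypothesis infP : ifr CS AS dlS RS ZS.
Hypothesis W_core : forall v w, inr w \in CH v.

Definition emb v (u : U) : player :=
  match u with inl ah => inl (ah.1, mk ah.2 v) | inr w => inr (inl w) end.

Definition frame_set (B : V -> {set U}) (D : {set S}) : {set player} :=
  [set p | match p with
           | inl ay => inl (ay.1, hd ay.2) \in B (pr ay.2)
           | inr s => s \in D
           end].
Notation frame_core := (frame_set CH CS).
Notation frame_spouses := (frame_set AH AS).
(* These hold when the holes have core [W] only and [CS] is empty, and when one hole is
   left open and there are no infinite players. *)
Hypothesis core_together : forall p p', p \in frame_core -> p' \in frame_core -> T_target p p' = 0.
Hypothesis core_W : forall v u, inl u \in CH v -> forall w, inl w \in CS.

Lemma sum_cosets (F : H -> V -> nat) : \sum_c F (hd c) (pr c) = \sum_h \sum_v F h v.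
Proof.
rewrite pair_big /= (reindex (fun hv : H * V => mk hv.1 hv.2)) /=.
  by apply: eq_bigr => -[h v] _; rewrite (hd_mk prP) (pr_mk prP).
exists (fun c => (hd c, pr c)) => [[h v]|c] _ /=; first by rewrite (hd_mk prP) (pr_mk prP).
exact: mk_hd prP c.
Qed.

Lemma emb_inj v : injective (emb v).
Proof.
case=> [[a h]|w] [[b k]|w'] //= [] => [-> hk|-> //].
by rewrite -(hd_mk prP h v) hk (hd_mk prP).
Qed.

Lemma inr_inj : injective (fun s : S => inr s : player).
Proof. by move=> s t []. Qed.

Definition finite_round (k : A) (c : G) : seq (quad player) :=
  flatten [seq [seq bgame c b q | q <- rows b & rsym q == inl k] | b <- enum I]
  ++ [seq qmap (emb (pr c)) g | g <- RH (pr c) (inl (k, hd c))].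

Definition infinite_round (e : I * bool) l : seq (quad player) :=
  flatten [seq [seq bgame c e.1 q
               | q <- rows e.1 & (rsym q == inr l) && (rhalf q == e.2)] | c <- enum (G : finType)].

Definition core_round w : seq (quad player) :=
  flatten [seq [seq qmap (emb v) g | g <- RH v (inr w)] | v <- enum V].

(** The pieces of a round use disjoint players. In a finite round the translated games leave out
    exactly one coset and [W], which the hole serves. In the round of a player of [S], the finite
    players are served by the holes or by a half of the rows, and [S] by its own schedule. *)
Definition frame_round (p : player) : seq (quad player) :=
  match p with
  | inl kc => finite_round kc.1 kc.2
  | inr s => match s with
             | inl w => core_round w
             | inr t => infinite_round (tag t) (val (tagged t))
             end ++ [seq qmap (fun t => inr t) g | g <- RS s]
  end.

Definition frame_short : seq (quad player) :=
  flatten [seq [seq qmap (emb v) g | g <- ZH v] | v <- enum V]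
  ++ [seq qmap (fun t => inr t) g | g <- ZS].

Lemma big_flat (J : finType) (Y : J -> seq (quad player)) F :
  \sum_(g <- flatten [seq Y i | i <- enum J]) F g = \sum_i \sum_(g <- Y i) F g.
Proof. by rewrite big_flatten big_map big_enum. Qed.

Lemma sum_finite_round F k c : \sum_(g <- finite_round k c) F g =
  \sum_b \sum_(q <- rows b | rsym q == inl k) F (bgame c b q) +
  \sum_(g <- RH (pr c) (inl (k, hd c))) F (qmap (emb (pr c)) g).
Proof.
rewrite big_cat big_flat big_map; congr (_ + _).
by apply: eq_bigr => d _; rewrite big_map big_filter.
Qed.

Lemma sum_infinite_round F e l : \sum_(g <- infinite_round e l) F g =
  \sum_(c : G) \sum_(q <- rows e.1 | (rsym q == inr l) && (rhalf q == e.2))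
    F (bgame c e.1 q).
Proof.
by rewrite big_flat; apply: eq_bigr => c _; rewrite big_map big_filter.
Qed.

Lemma sum_core_round F w : \sum_(g <- core_round w) F g =
  \sum_v \sum_(g <- RH v (inr w)) F (qmap (emb v) g).
Proof. by rewrite big_flat; apply: eq_bigr => c _; rewrite big_map. Qed.

Lemma tot_frame F :
  tot F frame_round frame_short =
  \sum_(c : G) \sum_b \sum_(q <- rows b) F (bgame c b q) +
  \sum_v tot (fun g => F (qmap (emb v) g)) (RH v) (ZH v) +
  tot (fun g => F (qmap (fun t => inr t) g)) RS ZS.
Proof.
pose hole v u := \sum_(g <- RH v u) F (qmap (emb v) g).
have EG : \sum_(kc : A * G) \sum_(g <- finite_round kc.1 kc.2) F g =
  \sum_(k : A) \sum_(c : G) \sum_b \sum_(q <- rows b | rsym q == inl k) F (bgame c b q) +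
  \sum_v \sum_(ah : A * H) hole v (inl ah).
  rewrite -(pair_bigA _ (fun k c => \sum_(g <- finite_round k c) F g)) /=.
  under eq_bigr => k _ do under eq_bigr => c _ do rewrite sum_finite_round.
  under eq_bigr => k _ do rewrite big_split /=.
  rewrite big_split /=; congr (_ + _); rewrite [RHS]exchange_big /=.
  transitivity (\sum_(ah : A * H) \sum_v hole v (inl (ah.1, ah.2))); last first.
    by apply: eq_bigr => -[].
  rewrite -(pair_bigA _ (fun k h => \sum_v hole v (inl (k, h)))) /=.
  apply: eq_bigr => k _.
  exact: (sum_cosets (fun h v => hole v (inl (k, h)))).
have EW : \sum_w \sum_(g <- core_round w) F g = \sum_v \sum_w hole v (inr w).
  by under eq_bigr => w _ do rewrite sum_core_round; apply: exchange_big.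
have EI : \sum_(t : infinite) \sum_(g <- infinite_round (tag t) (val (tagged t))) F g =
   \sum_(c : G) \sum_b \sum_(l < x b) \sum_(h : bool)
      \sum_(q <- rows b | (rsym q == inr (val l)) && (rhalf q == h)) F (bgame c b q).
  rewrite (sum_infinite (fun e l => \sum_(g <- infinite_round e l) F g)).
  rewrite -(pair_bigA _ (fun b h => \sum_(l < x b) \sum_(g <- infinite_round (b, h) l) F g)) /=.
  rewrite [RHS]exchange_big /=; apply: eq_bigr => b _.
  rewrite exchange_big /= [RHS]exchange_big /=; apply: eq_bigr => l _.
  rewrite [RHS]exchange_big /=; apply: eq_bigr => h _; exact: sum_infinite_round.
have EB : \sum_(c : G) \sum_b \sum_(q <- rows b) F (bgame c b q) =
  \sum_(k : A) \sum_(c : G) \sum_b \sum_(q <- rows b | rsym q == inl k) F (bgame c b q) +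
  \sum_(c : G) \sum_b \sum_(l < x b) \sum_(h : bool)
      \sum_(q <- rows b | (rsym q == inr (val l)) && (rhalf q == h)) F (bgame c b q).
  rewrite [X in _ = X + _]exchange_big -big_split /=; apply: eq_bigr => c _.
  rewrite [X in _ = X + _]exchange_big -big_split /=; apply: eq_bigr => b _.
  exact: (sum_row_split b (fun q => F (bgame c b q))).
rewrite /tot big_sumType /= EG.
under [X in _ + X + _]eq_bigr => s _ do rewrite big_cat /= big_map.
rewrite big_split /= big_sumType /= EW EI big_cat big_flat !big_map EB.
under [X in _ + (X + _) = _]eq_bigr => v _ do rewrite big_map.
under [X in _ = _ + X + _]eq_bigr => v _ do rewrite big_sumType /=.
rewrite [X in _ = _ + X + _]big_split [X in _ = _ + (X + _) + _]big_split /=.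
rewrite /hole.
have shuffle a b e f g h i : a + b + (e + f + g) + (h + i) = a + f + (b + e + h) + (g + i) by lia.
exact: shuffle.
Qed.

Definition frame_double s (p : player) : player :=
  match p with
  | inl ay => emb (pr ay.2) (dlH (pr ay.2) s (inl (ay.1, hd ay.2)))
  | inr t => inr (dlS s t)
  end.

Lemma hole_A v w : inr w \in AH v.
Proof. by apply: (subsetP (ifr_core (holeP v))); apply: W_core. Qed.

Lemma dlH_inr v s w : dlH v s (inr w) = inr w.
Proof. by apply/eqP; rewrite (ifr_fix (holeP v)) hole_A. Qed.

(** An involution that fixes every player of [W] preserves the complement of [W]. *)
Lemma dlH_inl v s ah : exists bk, dlH v s (inl ah) = inl bk.
Proof.
case E: (dlH v s (inl ah)) => [bk|w]; first by exists bk.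
by have := ifr_inv (holeP v) s (inl ah); rewrite E dlH_inr.
Qed.

Lemma emb_neq_inf v u t : emb v u != inr (inr t).
Proof. by case: u => //= w; apply/eqP => -[]. Qed.

Lemma emb_neq_inl v u a y : pr y != v -> emb v u != inl (a, y).
Proof.
by case: u => //= -[b k] yv; apply: contraNneq yv => -[_ <-]; rewrite (pr_mk prP).
Qed.

Lemma emb_hd a y : emb (pr y) (inl (a, hd y)) = inl (a, y).
Proof. by rewrite /emb /= (mk_hd prP). Qed.

Lemma tot0 (T : finType) (F : quad T -> nat) R Z : (forall g, F g = 0) -> tot F R Z = 0.
Proof. by move=> F0; rewrite /tot !big1 // => r _; rewrite big1. Qed.

Lemma eq_tot (T : finType) (F F' : quad T -> nat) R Z : F =1 F' -> tot F R Z = tot F' R Z.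
Proof.
move=> FF; rewrite /tot; congr (_ + _); last exact: eq_bigr.
by apply: eq_bigr => r _; apply: eq_bigr.
Qed.

Definition hole_part r p p' :=
  \sum_v tot (fun g => ind r p p' (qmap (emb v) g)) (RH v) (ZH v).

Definition hole_target v r u u' :=
  if (u \in CH v) && (u' \in CH v) then 0 else target (AH v) (dlH v) r u u'.

Lemma hole_partE r v u u' :
  (forall v', v' != v -> tot (fun g => ind r (emb v u) (emb v u') (qmap (emb v') g)) (RH v') (ZH v') = 0) ->
  hole_part r (emb v u) (emb v u') = hole_target v r u u'.
Proof.
move=> other; rewrite /hole_part (bigD1 v) //= big1 ?addn0 //.
rewrite /hole_target -(ifr_rel (holeP v)); apply: eq_tot => g.
exact: (ind_qmap (@emb_inj v)).
Qed.

Lemma hole_part_inl r v ah u : hole_part r (emb v (inl ah)) (emb v u) = hole_target v r (inl ah) u.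
Proof.
apply: hole_partE => v' vv'; apply: tot0 => g; apply: ind_qmap0l => u'.
by rewrite /= emb_neq_inl //= (pr_mk prP) eq_sym.
Qed.

Lemma hole_part_inr r v ah u : hole_part r (emb v u) (emb v (inl ah)) = hole_target v r u (inl ah).
Proof.
apply: hole_partE => v' vv'; apply: tot0 => g; apply: ind_qmap0r => u'.
by rewrite /= emb_neq_inl //= (pr_mk prP) eq_sym.
Qed.

Lemma emb_frame_set B D v ah : (emb v (inl ah) \in frame_set B D) = (inl ah \in B v).
Proof. by case: ah => a h; rewrite inE /= (hd_mk prP) (pr_mk prP). Qed.

Definition frame_target r p p' :=
  if (p \in frame_core) && (p' \in frame_core) then 0
  else target frame_spouses frame_double r p p'.

Lemma frame_core_apart p p' : T_target p p' = 1 -> (p \in frame_core) && (p' \in frame_core) = false.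
Proof.
by move=> T1; apply/negP => /andP[pc pc']; have := core_together pc pc'; rewrite T1.
Qed.

Lemma double_emb v s ah : frame_double s (emb v (inl ah)) = emb v (dlH v s (inl ah)).
Proof. by case: ah => a h; rewrite /= (hd_mk prP) (pr_mk prP). Qed.

Lemma target_apart r p p' : p != p' -> frame_double (rel_fst r) p != p' ->
  target frame_spouses frame_double r p p' = 1.
Proof. by rewrite /target => /negbTE-> /negbTE->; case: ifP. Qed.

Lemma frame_rel r p p' :
  tot (ind r p p') frame_round frame_short = frame_target r p p'.
Proof.
rewrite tot_frame T_rel -/(hole_part r p p').
case: p p' => [ay|s] [bz|s'].
- rewrite [X in _ + X]tot0 ?addn0 => [|g]; last exact: ind_qmap0l.
  case: ay bz => [a y] [b z].
  case: (eqVneq (pr y) (pr z)) => [yz|yz].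
    rewrite -(emb_hd a y) -(emb_hd b z) -yz; move: (hd y) (hd z) => h k.
    have -> : T_target (emb (pr y) (inl (a, h))) (emb (pr y) (inl (b, k))) = 0.
      by rewrite /= !(pr_mk prP) eqxx.
    rewrite add0n (hole_part_inl r (pr y) (a, h) (inl (b, k))).
    rewrite /frame_target /hole_target !emb_frame_set /target double_emb.
    by rewrite !(inj_eq (@emb_inj (pr y))) emb_frame_set.
  rewrite /= yz /frame_target frame_core_apart /= ?yz // target_apart; last 2 first.
  - by apply: contraNneq yz => -[_ ->].
  - have [bk E] := dlH_inl (pr y) (rel_fst r) (a, hd y).
    by rewrite /= E emb_neq_inl // eq_sym.
  rewrite /hole_part big1 // => v _.
  apply: tot0 => g; case: (eqVneq (pr y) v) yz => [-> vz|yv _].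
    by apply: ind_qmap0r => u; rewrite emb_neq_inl //= eq_sym.
  by apply: ind_qmap0l => u; rewrite emb_neq_inl.
- rewrite [X in _ + X]tot0 ?addn0 => [|g]; last exact: ind_qmap0l.
  case: ay => a y; have [bk E] := dlH_inl (pr y) (rel_fst r) (a, hd y).
  have t1 : target frame_spouses frame_double r (inl (a, y)) (inr s') = 1.
    by apply: target_apart => //=; rewrite E.
  case: s' t1 => [w|t] t1 /=.
    rewrite add0n -(emb_hd a y) (hole_part_inl r (pr y) (a, hd y) (inr w)) emb_hd.
    rewrite /frame_target t1 /hole_target W_core.
    rewrite !inE /= andbT; case: ifP => [hC|_]; first by rewrite (core_W hC).
    by rewrite /target /= E; case: ifP.
  rewrite /frame_target t1 frame_core_apart // /hole_part big1 // => v _.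
  by apply: tot0 => g; apply: ind_qmap0r => u; rewrite emb_neq_inf.
- rewrite [X in _ + X]tot0 ?addn0 => [|g]; last exact: ind_qmap0r.
  case: bz => b z.
  have t1 : target frame_spouses frame_double r (inr s) (inl (b, z)) = 1.
    exact: target_apart.
  case: s t1 => [w|t] t1 /=.
    rewrite add0n -(emb_hd b z) (hole_part_inr r (pr z) (b, hd z) (inr w)) emb_hd.
    rewrite /frame_target t1 /hole_target W_core.
    rewrite !inE /=; case: (boolP (inl (b, hd z) \in CH (pr z))) => [hC|_]; first by rewrite (core_W hC).
    by rewrite andbF /target /= dlH_inr; case: ifP.
  rewrite /frame_target t1 frame_core_apart // /hole_part big1 // => v _.
  by apply: tot0 => g; apply: ind_qmap0l => u; rewrite emb_neq_inf.
- have -> : T_target (inr s) (inr s') = 0 by case: s s' => [w|t] [w'|t'].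
  rewrite /hole_part big1 ?add0n => [|v _].
    rewrite (eq_tot (F' := ind r s s')) => [|g]; last exact: (ind_qmap inr_inj).
    by rewrite (ifr_rel infP) /frame_target /target !inE /= !(inj_eq inr_inj).
  case: s => [w|t]; last by apply: tot0 => g; apply: ind_qmap0l => u; apply: emb_neq_inf.
  case: s' => [w'|t]; last by apply: tot0 => g; apply: ind_qmap0r => u; apply: emb_neq_inf.
  (* Two players of [W] lie together in every hole, but in its core, so their only meetings come
     from the schedule on [S]. *)
  rewrite (eq_tot (F' := ind r (inr w) (inr w'))) => [|g].
    by rewrite (ifr_rel (holeP v)) !W_core.
  exact: (ind_qmap (@emb_inj v) r (inr w) (inr w')).
Qed.

Lemma sum_hole s v (L : seq (quad U)) p :
  \sum_(g <- L) ind1 s p (qmap (emb v) g) =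
  match p with
  | inl ay => (pr ay.2 == v) * \sum_(g <- L) ind1 s (inl (ay.1, hd ay.2)) g
  | inr (inl w) => \sum_(g <- L) ind1 s (inr w) g
  | inr (inr _) => 0
  end.
Proof.
case: p => [[a y]|[w|t]] /=.
- case: (eqVneq (pr y) v) => [<-|yv] /=; last first.
    by rewrite mul0n big1 // => g _; apply: ind1_qmap0 => u; apply: emb_neq_inl.
  rewrite mul1n -{1}(emb_hd a y); apply: eq_bigr => g _.
  exact: (ind1_qmap (@emb_inj (pr y)) s (inl (a, hd y))).
- apply: eq_bigr => g _; exact: (ind1_qmap (@emb_inj v) s (inr w)).
- by rewrite big1 // => g _; apply: ind1_qmap0 => u; apply: emb_neq_inf.
Qed.

Lemma sum_inf s (L : seq (quad S)) p :
  \sum_(g <- L) ind1 s p (qmap (fun t => inr t : player) g) =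
  if p is inr t then \sum_(g <- L) ind1 s t g else 0.
Proof.
case: p => [ay|t]; last by apply: eq_bigr => g _; apply: (ind1_qmap inr_inj).
by rewrite big1 // => g _; apply: ind1_qmap0.
Qed.

Lemma sum_infinite_part s (s1 : S) p :
  \sum_(g <- match s1 with
             | inl w => core_round w
             | inr t => infinite_round (tag t) (val (tagged t))
             end) ind1 s p g =
  match p, s1 with
  | inl ay, inl w => inl (ay.1, hd ay.2) \notin CH (pr ay.2) : nat
  | inl _, inr _ => 1
  | inr _, _ => 0
  end.
Proof.
case: s1 => [w|t]; last first.
  rewrite sum_infinite_round (T_inf_round _ _ _ (ltn_ord _)).
  by case: p.
rewrite sum_core_round; under eq_bigr => v _ do rewrite sum_hole.
case: p => [[a y]|[w'|t]] /=.
- rewrite (bigD1 (pr y)) //= eqxx mul1n (ifr_round_core (holeP (pr y))) ?W_core //.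
  rewrite big1 ?addn0 // => v; rewrite eq_sym => /negbTE->; exact: mul0n.
- by rewrite big1 // => v _; rewrite (ifr_round_core (holeP v)) ?W_core.
- by rewrite big1.
Qed.

Lemma frame_ifr :
  ifr frame_core frame_spouses frame_double frame_round frame_short.
Proof.
split.
- apply/subsetP => -[ay|s]; rewrite !inE.
    exact: (subsetP (ifr_core (holeP _))).
  exact: (subsetP (ifr_core infP)).
- move=> s [[a y]|t] /=; last by rewrite (ifr_inv infP).
  have [bk E] := dlH_inl (pr y) s (a, hd y).
  by rewrite E double_emb -E (ifr_inv (holeP (pr y))) emb_hd.
- move=> s [[a y]|t] /=; rewrite inE /=; last first.
    by rewrite (inj_eq inr_inj) (ifr_fix infP).
  by rewrite -(ifr_fix (holeP (pr y)) s) -(inj_eq (@emb_inj (pr y))) emb_hd.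
- exact: frame_rel.
- move=> s [[k c]|s1] rC.
    have rC' : inl (k, hd c) \notin CH (pr c) by move: rC; rewrite inE.
    have [u Hu] := ifr_round (holeP (pr c)) s rC'.
    (* Everyone outside the hole at [pr c] plays in the translated games, so the absentee is that of
       the hole's round. *)
    exists (emb (pr c) u) => p; rewrite sum_finite_round T_round sum_hole.
    case: p => [[a y]|[w|t]] /=.
    + case: (eqVneq (pr y) (pr c)) => [yc|yc] /=.
        by rewrite mul1n Hu -(inj_eq (@emb_inj (pr c))) -yc emb_hd.
      by rewrite mul0n addn0 eq_sym emb_neq_inl.
    + by rewrite Hu -(inj_eq (@emb_inj (pr c))).
    + by rewrite eq_sym emb_neq_inf.
  have sC : s1 \notin CS by move: rC; rewrite inE.
  have [b Hb] := ifr_round infP s sC; exists (inr b) => p.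
  rewrite big_cat /= big_map sum_inf sum_infinite_part.
  case: p => [ay|t]; last by rewrite add0n Hb (inj_eq inr_inj).
  rewrite addn0; case: s1 sC {rC Hb} => [w|t] // wC.
  by case: (boolP (_ \in _)) => // /core_W/(_ w); rewrite (negbTE wC).
- move=> s [[k c]|s1] p rC.
    have rC' : inl (k, hd c) \in CH (pr c) by move: rC; rewrite inE.
    rewrite sum_finite_round T_round sum_hole.
    case: p => [[a y]|[w|t]] /=.
    + case: (eqVneq (pr y) (pr c)) => [yc|yc] /=.
        by rewrite mul1n (ifr_round_core (holeP (pr c))) // inE /= yc.
      rewrite mul0n addn0; case: (boolP (_ \in _)) => // pC.
      by have := core_together rC pC; rewrite /= eq_sym yc.
    + by rewrite (ifr_round_core (holeP (pr c))) // W_core inE (core_W rC').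
    + case: (boolP (_ \in _)) => // pC.
      by have := core_together rC pC.
  have sC : s1 \in CS by move: rC; rewrite inE.
  rewrite big_cat /= big_map sum_inf sum_infinite_part.
  case: p => [[a y]|t]; last by rewrite add0n (ifr_round_core infP) // inE.
  rewrite addn0; case: s1 rC {sC} => [w|t] rC; first by rewrite inE.
  by case: (boolP (_ \in _)) => // pC; have := core_together rC pC.
- move=> s p; rewrite big_cat big_flat big_map /= sum_inf.
  under eq_bigr => v _ do rewrite big_map sum_hole.
  case: p => [[a y]|[w|t]] /=.
  + rewrite addn0 (bigD1 (pr y)) //= eqxx mul1n [X in _ + X]big1 ?addn0 => [|v].
      by rewrite inE; apply: (ifr_short (holeP (pr y))).
    by rewrite eq_sym => /negbTE->; apply: mul0n.
  + rewrite big1 ?add0n => [|v _]; first by rewrite inE; apply: (ifr_short infP).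
    by apply/eqP; rewrite -leqn0; have := ifr_short (holeP v) s (inr w); rewrite W_core.
  + by rewrite big1 // add0n inE; apply: (ifr_short infP).
Qed.

(** The common [W] is removed from each [B v]; its share of the union is decided by [D]. *)
Lemma card_frame_set (B : V -> {set U}) D : (forall v w, inr w \in B v) ->
  #|frame_set B D| = \sum_v (#|B v| - #|W|) + #|D|.
Proof.
move=> WB; rewrite -sum1_card big_sumType /=; congr (_ + _); last first.
  by rewrite -sum1_card; apply: eq_bigl => s; rewrite inE.
have cardB v : #|B v| - #|W| = \sum_(ah : A * H) (inl ah \in B v).
  rewrite -sum1_card big_sumType /= [X in _ + X](_ : _ = #|W|) ?addnK.
    by rewrite big_mkcond.
  by rewrite -sum1_card; apply: eq_bigl => w; rewrite WB.
under [RHS]eq_bigr => v _ do rewrite cardB.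
rewrite big_mkcond.
transitivity (\sum_(a : A) \sum_(h : H) \sum_(v : V) (inl (a, h) \in B v)).
  transitivity (\sum_(a : A) \sum_(c : G) (inl (a, hd c) \in B (pr c))).
    rewrite (pair_bigA _ (fun a c => inl (a, hd c) \in B (pr c) : nat)) /=.
    by apply: eq_bigr => -[a c] _; rewrite inE.
  by apply: eq_bigr => a _; apply: (sum_cosets (fun h v => inl (a, h) \in B v)).
rewrite [RHS]exchange_big /= (pair_bigA _ (fun a h => \sum_v (inl (a, h) \in B v))) /=.
by apply: eq_bigr => -[a h].
Qed.
End Frame.

(** * Cardinalities, and the two ways of using a frame *)

Lemma card_infinite (I : finType) (x : I -> nat) :
  #|{: {e : I * bool & 'I_(x e.1)}}| = 2 * \sum_b x b.
Proof.
rewrite card_tagged sumnE big_map big_enum /=.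
rewrite -(pair_bigA _ (fun b (h : bool) => #|'I_(x b)|)) /= big_distrr /=.
by apply: eq_bigr => b _; rewrite big_bool card_ord mul2n -addnn.
Qed.

Lemma card_inr (T W : finType) : #|[set inr w | w in W] : {set T + W}| = #|W|.
Proof. by rewrite card_imset // => u v []. Qed.

Lemma mem_inr (T W : finType) (w : W) : (inr w : T + W) \in [set inr w | w in W].
Proof. by rewrite imset_f. Qed.

Lemma mem_inl (T W : finType) (u : T) : ((inl u : T + W) \in [set inr w | w in W]) = false.
Proof. by apply/negP => /imsetP[]. Qed.

Lemma card_cosets (G V : finZmodType) (H : finType) (pr : G -> V) (hd : G -> H) mk :
  cosets pr hd mk -> #|G| = #|H| * #|V|.
Proof.
move=> prP; rewrite -sum1_card (sum_cosets prP (fun _ _ => 1)).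
by rewrite -card_prod -sum1_card pair_big.
Qed.

Lemma IFR_frame (G V : finZmodType) (H : finType) (pr : G -> V) (hd : G -> H) mk
    (I : finType) (base : I -> quad G)
    (A : finType) (a0 : A) (x : I -> nat) (rows : I -> seq (row A)) w kh ks :
  cosets pr hd mk -> starter pr base -> (forall b, itd (x b) (rows b)) ->
  IFR (#|A| * #|H| + w) w kh -> IFR (w + 2 * \sum_b x b) 0 ks ->
  IFR (#|A| * #|G| + (w + 2 * \sum_b x b)) 0 (#|V| * (kh - w) + ks).
Proof.
move=> prP baseP rowsP hole inf.
pose W : finType := 'I_w.
have cW : #|W| = w by rewrite card_ord.
have cU : #|{: A * H + W}| = #|A| * #|H| + w by rewrite card_sum card_prod cW.
pose CH : {set A * H + W} := [set inr w | w in W].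
have cCH : #|CH| = w by rewrite card_inr.
have [AH [dlH [RH [ZH [holeP cAH]]]]] := hole _ _ cU cCH.
have cS : #|{: W + {e : I * bool & 'I_(x e.1)}}| = w + 2 * \sum_b x b.
  by rewrite card_sum cW card_infinite.
have [AS [dlS [RS [ZS [infP cAS]]]]] := inf _ set0 cS (cards0 _).
pose p0 : A * G + (W + {e : I * bool & 'I_(x e.1)}) := inl (a0, 0%R).
have WB w0 : inr w0 \in AH.
  by apply: (subsetP (ifr_core holeP)); apply: mem_inr.
have core0 : frame_set pr hd (fun _ : V => CH) (set0 : {set W + {e : I * bool & 'I_(x e.1)}}) = set0.
  by apply/setP => -[ay|s]; rewrite !inE ?mem_inl.
have := frame_ifr prP baseP rowsP p0 (fun v : V => holeP) infP.
rewrite core0 => /(_ (fun _ w => @mem_inr _ _ w)) D.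
have {}D := IFR_intro (D _ _).
have -> : #|A| * #|G| + (w + 2 * \sum_b x b) =
  #|{: A * G + (W + {e : I * bool & 'I_(x e.1)})}|.
  by rewrite card_sum !card_prod cS.
have -> : #|V| * (kh - w) + ks = #|frame_set pr hd (fun _ : V => AH) AS|.
  by rewrite (card_frame_set prP) => [|_ //]; rewrite sum_nat_const cAH cAS cW.
rewrite -(cards0 (A * G + (W + {e : I * bool & 'I_(x e.1)}))%type).
by apply: D => [p p'|v u]; rewrite ?inE // mem_inl.
Qed.

Definition trivial_row : row unit := (inl tt, inl tt, inl tt, inl tt, inl tt, false).

Lemma itd_trivial : itd 0 [:: trivial_row].
Proof.
split=> //.
- by move=> p; rewrite inE => /eqP->; split=> // -[] [].
- by move=> s sg s' sg' [[]|//] [[]|//] _ _ _; rewrite big_seq1; case: s sg s' sg' => [] [] [] [].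
- by move=> s sg [[]|//] [[]|//] _ _; rewrite big_seq1; case: s sg => [] [].
Qed.

(** With everybody in the core there is nothing to play: this is the coset left open in
    [IFR_starter]. *)
Lemma ifr_full (T : finType) : ifr [set: T] setT (fun _ => id) (fun _ => [::]) [::].
Proof.
split=> //.
- by move=> s y; rewrite eqxx inE.
- by move=> r y z; rewrite /tot !inE big_nil addn0 big1 // => u _; rewrite big_nil.
- by move=> s r; rewrite inE.
- by move=> s r y _; rewrite inE big_nil.
- by move=> s y; rewrite big_nil.
Qed.

Lemma ifr_set0 (T : finType) : #|T| = 0 -> ifr (set0 : {set T}) set0 (fun _ => id) (fun _ => [::]) [::].
Proof. by move/card0_eq => T0; split=> //; do ?by [move=> s y; have := T0 y | move=> s r y; have := T0 y]. Qed.

(** The frame with one type, no [W] and no infinite players. Filling every coset gives the first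
    design, leaving the coset over 0 open gives the second. *)
Lemma IFR_starter (G V : finZmodType) (H : finType) (pr : G -> V) (hd : G -> H) mk
    (I : finType) (base : I -> quad G) kh :
  cosets pr hd mk -> starter pr base -> IFR #|H| 0 kh ->
  IFR #|G| 0 (#|V| * kh) /\ IFR #|G| #|H| (#|H| + #|V|.-1 * kh).
Proof.
move=> prP baseP hole.
have rowsP (b : I) : itd 0 [:: trivial_row] by apply: itd_trivial.
split.
  have := @IFR_frame G V H pr hd mk I base unit tt (fun _ => 0) _ 0 kh 0 prP baseP rowsP.
  rewrite card_unit !mul1n big1 // muln0 !addn0 subn0; apply=> // T C cT.
  move/eqP; rewrite cards_eq0 => /eqP->.
  by exists set0, (fun _ => id), (fun _ => [::]), [::]; rewrite cards0; split=> //; apply: ifr_set0.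
pose x := fun _ : I => 0; pose T := {e : I * bool & 'I_(x e.1)}.
have cU : #|{: unit * H + void}| = #|H| by rewrite card_sum card_prod card_unit card_void mul1n addn0.
have [AH [dlH [RH [ZH [holeP cAH]]]]] := hole _ set0 cU (cards0 _).
have cT : #|{: void + T}| = 0 by rewrite card_sum card_void card_infinite big1.
have infP := ifr_set0 cT.
pose holes (v : V) (B D : {set unit * H + void}) := if v == 0%R then B else D.
pose p0 : unit * G + (void + T) := inl (tt, 0%R).
have WB (B : V -> {set unit * H + void}) v (w : void) : inr w \in B v by case: w.
pose CH v := holes v setT set0; pose AH' v := holes v setT AH.
have holeP' v : ifr (CH v) (AH' v) (if v == 0%R then fun _ => id else dlH)
   (if v == 0%R then fun _ => [::] else RH) (if v == 0%R then [::] else ZH).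
  by rewrite /CH /AH' /holes; case: ifP => _ //; apply: ifr_full.
have D := @frame_ifr G V H pr hd mk I base unit void x _ prP baseP rowsP p0 _ _ _ _ _ _ _ _ _ _ holeP' infP (WB CH).
have {}D := IFR_intro (D _ _).
have cset (B D0 : {set unit * H + void}) : #|frame_set pr hd (fun v => holes v B D0) (set0 : {set void + T})| = #|B| + #|V|.-1 * #|D0|.
  rewrite (card_frame_set prP); last exact: (WB (fun v => holes v B D0)).
  rewrite card_void cards0 addn0; under eq_bigr => v _ do rewrite subn0 /holes.
  rewrite (bigD1 0%R) //= eqxx; congr (_ + _).
  rewrite (eq_bigr (fun _ => #|D0|)) => [|v /negbTE->//].
  by rewrite sum_nat_const cardC1.
have e1 : #|{: unit * G + (void + T)}| = #|G|.
  by rewrite card_sum !card_prod cT card_unit mul1n addn0.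
have e2 : #|frame_set pr hd CH (set0 : {set void + T})| = #|H| by rewrite cset cardsT cU cards0 muln0 addn0.
have e3 : #|frame_set pr hd AH' (set0 : {set void + T})| = #|H| + #|V|.-1 * kh by rewrite cset cardsT cU cAH.
rewrite -e1 -{1}e2 -e3.
apply: D; last by move=> v u _ [].
move=> [[a y]|t] [[b z]|t'];
  rewrite !inE /= /CH /holes //.
(* Two core players both lie in the coset over 0, and the translated games never join players of one
   coset. *)
by case: eqP => [->|]; case: eqP => [->|]; rewrite ?inE ?eqxx.
Qed.

(** * Starters in cyclic groups *)

HB.instance Definition _ (A B : finZmodType) := GRing.Zmodule.on (A * B)%type.

(* The pair [(u, v)] of naturals stands for an element of [Z_m x Z_n], [m = o.+1],
   [n = p.+1], and [out] is the complement of the hole subgroup. *)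
Section CyclicStarter.
Variables (o p : nat) (out : nat * nat -> bool) (B : seq (quad (nat * nat))).
Notation m := (o.+1).
Notation n := (p.+1).
Notation G := ('I_m * 'I_n)%type.

Definition to_point (z : nat * nat) : G := (inZp z.1, inZp z.2).
Definition sub_point (z t : nat * nat) := ((z.1 + (m - t.1)) %% m, (z.2 + (n - t.2)) %% n).

Definition points s := flatten [seq [:: pos g s true; pos g s false] | g <- B].
Definition differences r :=
  flatten [seq [:: sub_point (pos g (rel_snd r) (~~ rel_cross r)) (pos g (rel_fst r) true);
                   sub_point (pos g (rel_snd r) (rel_cross r)) (pos g (rel_fst r) false)] | g <- B].

Definition outside := [seq z <- [seq (u, v) | u <- iota 0 m, v <- iota 0 n] | out z].
(** A duplicate-free list inside [outside] and of the same length is a permutation of it; this form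
    of the starter conditions is checked by evaluation. *)
Definition hits_all (L : seq (nat * nat)) :=
  [&& uniq L, all (fun z => [&& z.1 < m, z.2 < n & out z]) L & size L == size outside].

Definition is_starter := [&& hits_all (points true), hits_all (points false)
  & all (fun r => hits_all (differences r)) [:: PartnerMW; OppMW; OppMM; OppWW]].

Lemma hits_allP L y : hits_all L -> \sum_(z <- L) (to_point z == y) = out (val y.1, val y.2).
Proof.
case/and3P => uL /allP bL /eqP sL.
have E z : z \in L -> (to_point z == y) = (z == (val y.1, val y.2)).
  move=> /bL; case: y z => [h v] [a b] /= /and3P[z1 z2 _].
  apply/eqP/eqP => [[<- <-]|[-> ->]] /=; first by rewrite !modn_small.
  by rewrite /to_point /=; congr (_, _); apply: val_inj; rewrite /= modn_small.
pose z0 : nat * nat := (val y.1, val y.2).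
rewrite (eq_big_seq (fun z => (z == z0) : nat)) => [|z /E->//].
have -> : \sum_(z <- L) (z == z0) = count_mem z0 L.
  by rewrite -sum1_count [RHS]big_mkcond /=; apply: eq_bigr => z _; case: eqP.
rewrite count_uniq_mem //; congr nat_of_bool.
have mem_out z : (z \in outside) = [&& z.1 < m, z.2 < n & out z].
  rewrite mem_filter andbC [RHS]andbA; congr (_ && _).
  case: z => u v; apply/allpairsP/andP => [[[a b] [ma mb [-> ->]]]|[um vn]].
    by move: ma mb; rewrite !mem_iota.
  by exists (u, v); rewrite !mem_iota.
have sub : {subset L <= outside} by move=> z /bL; rewrite mem_out.
have [_ ->] := uniq_min_size uL sub (eq_leq (esym sL)).
by rewrite mem_out /= !ltn_ord.
Qed.

Lemma to_point_sub z t : (t.1 < m) && (t.2 < n) ->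
  (to_point z - to_point t)%R = to_point (sub_point z t).
Proof.
case: z t => [a b] [c d] /= /andP[c3 dn].
rewrite /to_point /sub_point; congr (_, _); apply: val_inj => /=.
  by rewrite (modn_small c3) modnDm modn_mod.
by rewrite (modn_small dn) modnDm modn_mod.
Qed.

Lemma starter_of_seq (V : finZmodType) (pr : G -> V) : is_starter ->
  (forall y, (pr y != 0%R) = out (val y.1, val y.2)) ->
  starter pr (fun i : 'I_(size B) => qmap to_point (nth (0, 0, (0, 0), (0, 0), (0, 0)) B i)).
Proof.
case/and3P => pT pF /and4P[d1 d2 d3 /andP[d4 _]] prE.
have pS s : hits_all (points s) by case: s.
pose g0 : quad (nat * nat) := (0, 0, (0, 0), (0, 0), (0, 0)).
have sumB (F : quad (nat * nat) -> nat) : \sum_(i < size B) F (nth g0 B i) = \sum_(g <- B) F g.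
  by rewrite (big_nth g0) big_mkord.
split=> [s y|r y]; rewrite prE.
  rewrite (sumB (fun g => \sum_(sg : bool) (pos (qmap to_point g) s sg == y))).
  rewrite -(hits_allP y (pS s)) /points big_flatten big_map; apply: eq_bigr => g _.
  by rewrite big_bool !big_cons big_nil /= addn0 !pos_qmap.
rewrite (sumB (fun g => \sum_(sg : bool) ((pos (qmap to_point g) (rel_snd r) (sg (+) rel_cross r) -
   pos (qmap to_point g) (rel_fst r) sg)%R == y))).
have dr : hits_all (differences r) by case: (r).
rewrite -(hits_allP y dr) /differences big_flatten big_map; apply: eq_big_seq => g gB.
have bnd s sg : ((pos g s sg).1 < m) && ((pos g s sg).2 < n).
  have /and3P[_ /allP bL _] := pS s.
  have /bL/and3P[-> -> _] // : pos g s sg \in points s.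
  by apply/flattenP; exists [:: pos g s true; pos g s false]; rewrite ?map_f //; case: sg; rewrite !inE eqxx ?orbT.
by rewrite big_bool !big_cons big_nil /= addn0 !pos_qmap !to_point_sub // addTb addFb.
Qed.
End CyclicStarter.

(* Starters in [Z_3 x Z_n] with hole [Z_3 x 0], except for [base27]; found by computer. *)
Definition base5 : seq (quad (nat * nat)) := [::
  ((0, 3), (2, 4), (0, 2), (2, 1));
  ((2, 1), (0, 4), (1, 3), (2, 2));
  ((2, 3), (1, 1), (0, 4), (0, 2));
  ((1, 1), (1, 2), (1, 4), (1, 3));
  ((2, 2), (1, 4), (0, 1), (0, 3));
  ((1, 2), (2, 3), (2, 4), (0, 1))].

Definition base7 : seq (quad (nat * nat)) := [::
  ((0, 3), (1, 5), (2, 4), (2, 2));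
  ((0, 2), (0, 1), (0, 4), (1, 3));
  ((1, 6), (0, 4), (0, 1), (0, 3));
  ((0, 6), (2, 5), (1, 3), (2, 1));
  ((2, 5), (1, 1), (1, 2), (2, 6));
  ((2, 2), (0, 5), (2, 1), (2, 4));
  ((1, 5), (0, 2), (2, 6), (2, 3));
  ((1, 1), (1, 2), (1, 4), (0, 6));
  ((0, 5), (1, 6), (2, 3), (1, 4))].

Definition base9 : seq (quad (nat * nat)) := [::
  ((0, 1), (2, 2), (0, 8), (2, 7));
  ((1, 2), (2, 3), (1, 7), (2, 6));
  ((2, 3), (2, 4), (2, 6), (2, 5));
  ((1, 4), (1, 8), (1, 5), (1, 1));
  ((2, 4), (0, 7), (0, 6), (1, 2));
  ((2, 5), (0, 2), (0, 3), (1, 7));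
  ((0, 2), (0, 8), (1, 3), (2, 1));
  ((0, 7), (0, 1), (1, 6), (2, 8));
  ((1, 1), (0, 4), (2, 7), (1, 5));
  ((1, 8), (0, 5), (2, 2), (1, 4));
  ((2, 1), (1, 6), (0, 5), (0, 3));
  ((2, 8), (1, 3), (0, 4), (0, 6))].

Definition base11 : seq (quad (nat * nat)) := [::
  ((0, 9), (0, 10), (2, 4), (1, 5));
  ((0, 2), (0, 1), (2, 7), (1, 6));
  ((0, 4), (0, 9), (1, 5), (1, 7));
  ((0, 7), (0, 2), (1, 6), (1, 4));
  ((2, 2), (1, 8), (0, 10), (2, 7));
  ((0, 1), (2, 4), (2, 9), (1, 3));
  ((1, 1), (2, 6), (0, 8), (1, 9));
  ((0, 3), (1, 2), (1, 10), (2, 5));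
  ((2, 5), (0, 8), (1, 3), (2, 1));
  ((2, 6), (0, 3), (1, 8), (2, 10));
  ((0, 6), (2, 2), (0, 5), (2, 9));
  ((1, 2), (1, 10), (1, 9), (1, 1));
  ((2, 1), (2, 8), (2, 10), (2, 3));
  ((2, 8), (0, 4), (2, 3), (0, 7));
  ((1, 4), (0, 6), (1, 7), (0, 5))].

Definition base13 : seq (quad (nat * nat)) := [::
  ((1, 1), (0, 2), (2, 7), (0, 10));
  ((2, 8), (0, 4), (1, 3), (0, 6));
  ((2, 11), (0, 12), (1, 9), (0, 5));
  ((2, 2), (2, 5), (2, 9), (1, 1));
  ((2, 1), (1, 3), (2, 6), (2, 2));
  ((2, 5), (2, 6), (2, 3), (1, 9));
  ((2, 4), (2, 8), (1, 6), (0, 1));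
  ((1, 5), (0, 3), (2, 12), (2, 11));
  ((2, 10), (2, 7), (1, 2), (0, 9));
  ((1, 4), (2, 12), (0, 7), (1, 11));
  ((0, 8), (1, 7), (1, 12), (2, 10));
  ((1, 10), (2, 4), (0, 11), (1, 8));
  ((0, 6), (1, 12), (1, 7), (1, 2));
  ((0, 5), (1, 10), (1, 8), (1, 6));
  ((0, 2), (1, 4), (1, 11), (1, 5));
  ((0, 3), (0, 8), (0, 4), (2, 1));
  ((0, 9), (0, 11), (0, 12), (2, 3));
  ((0, 1), (0, 7), (0, 10), (2, 9))].

Definition base15 : seq (quad (nat * nat)) := [::
  ((2, 1), (0, 8), (2, 14), (0, 7));
  ((1, 2), (2, 12), (1, 13), (2, 3));
  ((0, 3), (2, 13), (0, 12), (2, 2));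
  ((0, 4), (1, 6), (0, 11), (1, 9));
  ((1, 5), (1, 4), (1, 10), (1, 11));
  ((1, 6), (1, 14), (1, 9), (1, 1));
  ((1, 7), (0, 5), (1, 8), (0, 10));
  ((2, 4), (1, 12), (0, 8), (2, 11));
  ((2, 11), (1, 3), (0, 7), (2, 4));
  ((2, 7), (0, 13), (0, 9), (2, 8));
  ((2, 8), (0, 2), (0, 6), (2, 7));
  ((2, 3), (0, 4), (0, 2), (2, 6));
  ((2, 12), (0, 11), (0, 13), (2, 9));
  ((0, 5), (2, 14), (1, 12), (1, 8));
  ((0, 10), (2, 1), (1, 3), (1, 7));
  ((1, 1), (1, 10), (2, 6), (0, 3));
  ((1, 14), (1, 5), (2, 9), (0, 12));
  ((2, 2), (2, 5), (0, 14), (0, 9));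
  ((2, 13), (2, 10), (0, 1), (0, 6));
  ((1, 4), (1, 2), (2, 10), (0, 14));
  ((1, 11), (1, 13), (2, 5), (0, 1))].

Definition base17 : seq (quad (nat * nat)) := [::
  ((1, 1), (2, 2), (0, 3), (0, 15));
  ((1, 4), (2, 8), (0, 12), (0, 9));
  ((1, 16), (2, 15), (0, 14), (0, 2));
  ((1, 13), (2, 9), (0, 5), (0, 8));
  ((1, 2), (1, 3), (2, 13), (2, 11));
  ((1, 8), (1, 12), (2, 1), (2, 10));
  ((2, 4), (2, 6), (1, 15), (1, 14));
  ((1, 9), (1, 5), (2, 16), (2, 7));
  ((1, 7), (0, 10), (0, 2), (2, 3));
  ((1, 11), (0, 6), (0, 8), (2, 12));
  ((1, 10), (0, 7), (0, 15), (2, 14));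
  ((0, 9), (2, 5), (1, 6), (0, 11));
  ((2, 5), (0, 16), (0, 6), (2, 4));
  ((2, 3), (0, 13), (0, 7), (2, 16));
  ((2, 12), (0, 1), (0, 11), (2, 13));
  ((2, 14), (0, 4), (0, 10), (2, 1));
  ((2, 2), (1, 13), (2, 15), (1, 4));
  ((2, 8), (1, 1), (2, 9), (1, 16));
  ((1, 5), (1, 15), (1, 12), (1, 2));
  ((1, 14), (1, 8), (1, 3), (1, 9));
  ((0, 1), (1, 6), (0, 16), (1, 11));
  ((0, 4), (1, 7), (0, 13), (1, 10));
  ((2, 11), (0, 3), (2, 6), (0, 14));
  ((2, 7), (0, 5), (2, 10), (0, 12))].

Definition base19 : seq (quad (nat * nat)) := [::
  ((0, 3), (1, 7), (2, 12), (0, 14));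
  ((0, 2), (1, 11), (2, 8), (0, 3));
  ((0, 17), (1, 8), (2, 11), (0, 16));
  ((0, 14), (1, 1), (2, 18), (0, 2));
  ((0, 5), (1, 18), (2, 1), (0, 17));
  ((0, 16), (1, 12), (2, 7), (0, 5));
  ((1, 15), (0, 1), (2, 10), (1, 6));
  ((1, 6), (0, 8), (2, 4), (1, 10));
  ((1, 10), (0, 7), (2, 13), (1, 4));
  ((1, 4), (0, 18), (2, 9), (1, 13));
  ((1, 13), (0, 11), (2, 15), (1, 9));
  ((1, 9), (0, 12), (2, 6), (1, 15));
  ((1, 11), (1, 14), (2, 3), (2, 4));
  ((1, 1), (1, 3), (2, 2), (2, 9));
  ((1, 7), (1, 2), (2, 14), (2, 6));
  ((1, 18), (1, 16), (2, 17), (2, 10));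
  ((1, 8), (1, 5), (2, 16), (2, 15));
  ((1, 12), (1, 17), (2, 5), (2, 13));
  ((1, 2), (2, 14), (1, 17), (2, 5));
  ((1, 5), (2, 16), (1, 14), (2, 3));
  ((1, 3), (2, 2), (1, 16), (2, 17));
  ((0, 1), (2, 8), (0, 18), (2, 11));
  ((0, 7), (2, 18), (0, 12), (2, 1));
  ((0, 8), (2, 7), (0, 11), (2, 12));
  ((0, 4), (0, 13), (0, 15), (0, 6));
  ((0, 9), (0, 15), (0, 10), (0, 4));
  ((0, 6), (0, 10), (0, 13), (0, 9))].

Definition base23 : seq (quad (nat * nat)) := [::
  ((0, 1), (0, 5), (0, 22), (0, 18));
  ((1, 2), (1, 19), (1, 21), (1, 4));
  ((2, 3), (1, 2), (2, 20), (1, 21));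
  ((0, 4), (2, 13), (0, 19), (2, 10));
  ((2, 5), (1, 17), (2, 18), (1, 6));
  ((2, 6), (2, 8), (2, 17), (2, 15));
  ((1, 7), (2, 11), (1, 16), (2, 12));
  ((0, 8), (1, 9), (0, 15), (1, 14));
  ((1, 9), (2, 7), (1, 14), (2, 16));
  ((1, 10), (0, 20), (1, 13), (0, 3));
  ((0, 11), (0, 1), (0, 12), (0, 22));
  ((1, 1), (1, 13), (2, 11), (2, 20));
  ((1, 22), (1, 10), (2, 12), (2, 3));
  ((1, 5), (0, 13), (2, 21), (2, 14));
  ((1, 18), (0, 10), (2, 2), (2, 9));
  ((2, 1), (1, 18), (0, 20), (0, 21));
  ((2, 22), (1, 5), (0, 3), (0, 2));
  ((0, 9), (2, 6), (1, 17), (0, 19));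
  ((0, 14), (2, 17), (1, 6), (0, 4));
  ((2, 10), (1, 3), (0, 16), (0, 11));
  ((2, 13), (1, 20), (0, 7), (0, 12));
  ((2, 4), (0, 7), (0, 6), (2, 1));
  ((2, 19), (0, 16), (0, 17), (2, 22));
  ((1, 4), (1, 1), (2, 9), (0, 15));
  ((1, 19), (1, 22), (2, 14), (0, 8));
  ((0, 10), (1, 15), (1, 11), (2, 19));
  ((0, 13), (1, 8), (1, 12), (2, 4));
  ((2, 7), (0, 14), (0, 21), (2, 2));
  ((2, 16), (0, 9), (0, 2), (2, 21));
  ((0, 5), (1, 16), (1, 8), (2, 18));
  ((0, 18), (1, 7), (1, 15), (2, 5));
  ((1, 3), (1, 11), (2, 15), (0, 6));
  ((1, 20), (1, 12), (2, 8), (0, 17))].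

Definition base27 : seq (quad (nat * nat)) := [::
  ((7, 4), (0, 2), (6, 7), (1, 5));
  ((2, 7), (2, 5), (4, 4), (6, 5));
  ((0, 7), (7, 2), (8, 7), (2, 8));
  ((1, 1), (3, 3), (4, 6), (1, 0));
  ((2, 4), (6, 3), (1, 3), (1, 6));
  ((6, 4), (0, 3), (4, 0), (7, 3));
  ((3, 4), (4, 2), (1, 5), (0, 7));
  ((7, 1), (6, 2), (6, 5), (7, 4));
  ((8, 4), (8, 5), (2, 8), (2, 7));
  ((4, 1), (5, 5), (2, 3), (3, 8));
  ((5, 4), (1, 2), (5, 6), (2, 2));
  ((0, 4), (3, 2), (2, 0), (4, 8));
  ((6, 8), (8, 8), (4, 7), (8, 1));
  ((5, 2), (7, 5), (2, 1), (0, 1));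
  ((7, 8), (3, 5), (3, 1), (1, 7));
  ((5, 8), (0, 5), (1, 2), (3, 6));
  ((4, 5), (5, 8), (3, 2), (0, 6));
  ((0, 5), (4, 5), (5, 5), (6, 6));
  ((2, 6), (2, 3), (7, 3), (2, 4));
  ((8, 0), (5, 6), (1, 0), (6, 4));
  ((8, 3), (2, 0), (1, 6), (1, 1));
  ((1, 7), (4, 3), (6, 6), (1, 8));
  ((8, 1), (7, 0), (3, 6), (0, 8));
  ((0, 1), (7, 6), (0, 6), (8, 2));
  ((8, 2), (2, 6), (4, 3), (8, 7));
  ((1, 8), (8, 0), (7, 0), (6, 7));
  ((0, 8), (8, 3), (7, 6), (4, 4));
  ((4, 2), (2, 1), (4, 8), (8, 4));
  ((6, 2), (3, 1), (3, 8), (3, 4));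
  ((8, 5), (4, 7), (2, 2), (7, 1));
  ((2, 5), (5, 7), (3, 7), (5, 3));
  ((7, 2), (3, 7), (1, 4), (8, 6));
  ((0, 2), (1, 4), (5, 7), (5, 0));
  ((3, 3), (0, 4), (7, 5), (6, 8));
  ((6, 3), (4, 1), (3, 5), (5, 2));
  ((0, 3), (5, 4), (8, 8), (7, 8));
  ((5, 0), (1, 3), (5, 1), (6, 1));
  ((5, 3), (4, 0), (6, 1), (7, 7));
  ((8, 6), (4, 6), (7, 7), (5, 1))].

Definition base31 : seq (quad (nat * nat)) := [::
  ((0, 1), (1, 6), (2, 16), (2, 25));
  ((0, 27), (1, 7), (2, 29), (2, 24));
  ((0, 4), (1, 24), (2, 2), (2, 7));
  ((0, 23), (1, 14), (2, 27), (2, 17));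
  ((0, 15), (1, 28), (2, 23), (2, 3));
  ((0, 16), (1, 3), (2, 8), (2, 28));
  ((0, 30), (1, 25), (2, 15), (2, 6));
  ((0, 8), (1, 17), (2, 4), (2, 14));
  ((0, 2), (1, 12), (2, 1), (2, 19));
  ((0, 29), (1, 19), (2, 30), (2, 12));
  ((1, 7), (2, 21), (2, 25), (1, 29));
  ((1, 28), (2, 22), (2, 7), (1, 23));
  ((1, 12), (2, 5), (2, 3), (1, 1));
  ((1, 3), (2, 9), (2, 24), (1, 8));
  ((1, 14), (2, 11), (2, 19), (1, 27));
  ((1, 19), (2, 26), (2, 28), (1, 30));
  ((1, 25), (2, 13), (2, 14), (1, 15));
  ((1, 17), (2, 20), (2, 12), (1, 4));
  ((1, 6), (2, 18), (2, 17), (1, 16));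
  ((1, 24), (2, 10), (2, 6), (1, 2));
  ((1, 20), (0, 10), (2, 13), (2, 15));
  ((1, 18), (0, 9), (2, 21), (2, 29));
  ((1, 10), (0, 5), (2, 22), (2, 23));
  ((1, 21), (0, 26), (2, 9), (2, 8));
  ((1, 13), (0, 22), (2, 10), (2, 2));
  ((1, 22), (0, 11), (2, 5), (2, 1));
  ((1, 9), (0, 20), (2, 26), (2, 30));
  ((1, 11), (0, 21), (2, 18), (2, 16));
  ((1, 26), (0, 13), (2, 20), (2, 4));
  ((1, 5), (0, 18), (2, 11), (2, 27));
  ((0, 10), (0, 7), (0, 21), (0, 24));
  ((0, 13), (0, 6), (0, 18), (0, 25));
  ((0, 9), (0, 28), (0, 22), (0, 3));
  ((0, 11), (0, 17), (0, 20), (0, 14));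
  ((0, 5), (0, 19), (0, 26), (0, 12));
  ((1, 8), (0, 15), (1, 23), (0, 16));
  ((1, 15), (0, 1), (1, 16), (0, 30));
  ((1, 1), (0, 29), (1, 30), (0, 2));
  ((1, 4), (0, 23), (1, 27), (0, 8));
  ((1, 2), (0, 27), (1, 29), (0, 4));
  ((0, 7), (1, 22), (0, 24), (1, 9));
  ((0, 3), (1, 5), (0, 28), (1, 26));
  ((0, 12), (1, 20), (0, 19), (1, 11));
  ((0, 14), (1, 13), (0, 17), (1, 18));
  ((0, 6), (1, 10), (0, 25), (1, 21))].

Definition base39 : seq (quad (nat * nat)) := [::
  ((0, 27), (0, 15), (0, 12), (0, 24));
  ((0, 15), (0, 30), (0, 24), (0, 9));
  ((0, 3), (0, 6), (0, 36), (0, 33));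
  ((0, 30), (0, 21), (0, 9), (0, 18));
  ((0, 18), (0, 36), (0, 21), (0, 3));
  ((0, 6), (0, 12), (0, 33), (0, 27));
  ((0, 31), (2, 22), (0, 11), (1, 5));
  ((1, 28), (0, 1), (2, 20), (0, 2));
  ((1, 7), (0, 28), (2, 2), (0, 14));
  ((1, 8), (2, 32), (2, 19), (1, 16));
  ((0, 37), (2, 31), (0, 5), (1, 35));
  ((1, 32), (2, 29), (2, 34), (1, 19));
  ((1, 34), (1, 23), (2, 9), (0, 29));
  ((2, 27), (2, 35), (2, 37), (0, 17));
  ((0, 7), (2, 38), (2, 3), (1, 14));
  ((1, 27), (1, 22), (1, 11), (0, 4));
  ((0, 20), (1, 25), (1, 3), (2, 1));
  ((1, 9), (0, 16), (2, 8), (2, 10));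
  ((1, 10), (0, 38), (2, 6), (2, 13));
  ((0, 25), (1, 17), (2, 15), (1, 13));
  ((1, 6), (1, 26), (2, 23), (0, 25));
  ((1, 18), (0, 26), (1, 17), (1, 10));
  ((2, 18), (0, 13), (2, 4), (2, 23));
  ((0, 38), (2, 4), (1, 15), (2, 26));
  ((1, 33), (0, 10), (2, 38), (2, 37));
  ((1, 25), (1, 11), (2, 33), (0, 23));
  ((1, 21), (1, 4), (1, 23), (0, 7));
  ((0, 17), (1, 34), (1, 24), (2, 25));
  ((0, 4), (2, 8), (2, 24), (1, 38));
  ((2, 21), (2, 17), (2, 10), (0, 20));
  ((0, 23), (2, 33), (2, 29), (0, 22));
  ((1, 4), (1, 21), (2, 22), (2, 14));
  ((0, 1), (1, 29), (2, 25), (1, 24));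
  ((0, 10), (1, 33), (1, 16), (0, 35));
  ((1, 35), (1, 1), (2, 17), (2, 21));
  ((0, 14), (2, 16), (1, 38), (2, 24));
  ((1, 26), (2, 5), (2, 16), (1, 6));
  ((1, 1), (1, 15), (2, 26), (0, 32));
  ((0, 13), (2, 28), (0, 35), (2, 18));
  ((1, 13), (0, 19), (2, 14), (2, 15));
  ((1, 29), (2, 6), (2, 13), (1, 31));
  ((0, 22), (1, 18), (0, 26), (1, 2));
  ((0, 29), (1, 3), (1, 2), (2, 11));
  ((1, 31), (0, 34), (2, 1), (2, 27));
  ((0, 16), (2, 3), (2, 28), (1, 37));
  ((0, 32), (1, 20), (2, 35), (1, 9));
  ((1, 14), (1, 27), (2, 5), (0, 8));
  ((0, 19), (2, 7), (1, 22), (2, 9));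
  ((0, 2), (2, 36), (1, 30), (0, 31));
  ((1, 12), (1, 28), (2, 32), (2, 30));
  ((0, 28), (1, 36), (2, 30), (0, 5));
  ((1, 19), (1, 30), (2, 12), (2, 2));
  ((1, 36), (2, 19), (1, 5), (2, 12));
  ((2, 36), (1, 32), (2, 31), (1, 12));
  ((0, 34), (2, 20), (0, 8), (1, 7));
  ((1, 20), (0, 37), (2, 7), (0, 11));
  ((1, 37), (1, 8), (2, 11), (2, 34))].

(** * Incomplete transversal designs *)

(* Symbols are coded by naturals: [z < t] is a finite type and [t + l] is the [l]-th
   infinite symbol.  A row lists [a], [f], [b], [g], the round symbol and the half. *)
Section CodedITD.
Variables (t x : nat).
Definition nat_row := (quad nat * nat * bool)%type.
Implicit Types (p : nat_row) (L : seq nat_row).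

Definition to_symbol (z : nat) : symbol 'I_t := if insub z is Some a then inl a else inr (z - t).
Definition to_row p : row 'I_t := (qmap to_symbol p.1.1, to_symbol p.1.2, p.2).
Definition code (u : symbol 'I_t) : nat := match u with inl a => val a | inr l => t + l end.

Definition column (c : option (bool * bool)) p : nat :=
  if c is Some d then pos p.1.1 d.1 d.2 else p.1.2.
Definition columns := None :: [seq Some (s, sg) | s <- [:: true; false], sg <- [:: true; false]].
Definition meeting_pairs :=
  [seq z <- [seq (u, v) | u <- iota 0 (t + x), v <- iota 0 (t + x)] | (z.1 < t) || (z.2 < t)].
Definition all_meet L c c' :=
  let P := [seq (column c p, column c' p) | p <- L] in
  [&& uniq P, size P == size meeting_pairs
    & all (fun z => [&& z.1 < t + x, z.2 < t + x & (z.1 < t) || (z.2 < t)]) P].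
Definition half_types L s h l :=
  flatten [seq [:: pos p.1.1 s true; pos p.1.1 s false] | p <- L & (p.1.2 == t + l) && (p.2 == h)].
Definition half_ok L s h l :=
  let P := half_types L s h l in [&& uniq P, size P == t & all (fun z => z < t) P].

Definition is_itd L :=
  all (fun c => all (fun c' => (c == c') || all_meet L c c') columns) columns &&
  all (fun s => all (fun h => all (half_ok L s h) (iota 0 x)) [:: true; false]) [:: true; false].

Lemma to_symbol_code z u : z < t + x -> valid_sym x u -> (to_symbol z == u) = (z == code u).
Proof.
rewrite /to_symbol; case: insubP => [a zt <- _|zt zx]; case: u => [b|l] /= vu.
- by rewrite -[_ == _]/(a == b).
- by rewrite -[LHS]/false; have := ltn_ord a; lia.
- by rewrite -[LHS]/false; have := ltn_ord b; lia.
- by rewrite -[LHS]/(z - t == l); lia.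
Qed.

Lemma code_lt u : valid_sym x u -> code u < t + x.
Proof. by case: u => [a|l] /= v; rewrite ?ltn_add2l // ltn_addr. Qed.

Lemma code_finite u : (code u < t) = ~~ is_inf u.
Proof. by case: u => [a|l] /=; rewrite ?ltn_ord // ltnNge leq_addr. Qed.

Lemma mem_meeting z : (z \in meeting_pairs) = [&& z.1 < t + x, z.2 < t + x & (z.1 < t) || (z.2 < t)].
Proof.
rewrite mem_filter andbC [RHS]andbA; congr (_ && _).
case: z => u v /=; apply/allpairsP/andP => [[[a b] /= [ma mb [-> ->]]]|[ut vt]].
  by move: ma mb; rewrite !mem_iota.
by exists (u, v); rewrite !mem_iota.
Qed.

Lemma sum_all_meet L c c' u v : all_meet L c c' -> valid_sym x u -> valid_sym x v ->
  \sum_(p <- L) ((to_symbol (column c p) == u) && (to_symbol (column c' p) == v)) =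
  ~~ (is_inf u && is_inf v).
Proof.
case/and3P; set P := map _ _ => uP /eqP sP /allP bP vu vv.
transitivity (\sum_(z <- P) (z == (code u, code v))).
  rewrite big_map; apply: eq_big_seq => p pL.
  have /and3P[c1 c2 _] := bP (column c p, column c' p) (map_f _ pL).
  by rewrite !to_symbol_code.
have -> : \sum_(z <- P) (z == (code u, code v)) = count_mem (code u, code v) P.
  by rewrite -sum1_count [RHS]big_mkcond /=; apply: eq_bigr => z _; case: eqP.
have sub : {subset P <= meeting_pairs} by move=> z /bP; rewrite mem_meeting.
have [_ eqP'] := uniq_min_size uP sub (eq_leq (esym sP)).
rewrite count_uniq_mem // eqP' mem_meeting /= !code_lt // !code_finite.
by rewrite negb_and.
Qed.

Lemma itd_of_seq L : is_itd L -> itd x [seq to_row p | p <- L].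
Proof.
case/andP => /allP meet /and3P[halft halff _].
have pos_col s sg p : pos (to_row p).1.1 s sg = to_symbol (column (Some (s, sg)) p).
  by rewrite pos_qmap.
have in_col c : c \in columns by case: c => [[[] []]|].
have meetP c c' : c != c' -> all_meet L c c'.
  by move=> cc; have /allP/(_ c' (in_col c')) := meet c (in_col c); rewrite (negbTE cc).
have column_lt c p : p \in L -> column c p < t + x.
  have [c' cc] : exists c', c != c'.
    by case: c => [d|]; [exists None | exists (Some (true, true))].
  have /and3P[_ _ /allP bP] := meetP c c' cc.
  by move=> pL; have /and3P[] := bP _ (map_f (fun p => (column c p, column c' p)) pL).
have valid_col z : z < t + x -> valid_sym x (to_symbol z).
  by rewrite /to_symbol; case: insubP => //= zt zx; lia.
split.
- move=> _ /mapP[p pL ->]; split=> [s sg|].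
    by rewrite pos_col; apply/valid_col/column_lt.
  exact/valid_col/(column_lt None).
- move=> s sg s' sg' u v ne vu vv; rewrite big_map.
  rewrite -(@sum_all_meet L (Some (s, sg)) (Some (s', sg'))) //; last exact: meetP.
  by apply: eq_bigr => p _; rewrite !pos_col.
- move=> s sg u v vu vv; rewrite big_map.
  rewrite -(@sum_all_meet L (Some (s, sg)) None) //; last exact: meetP.
  by apply: eq_bigr => p _; rewrite !pos_col.
move=> s h l a lx.
have : half_ok L s h l.
  have lI : l \in iota 0 x by rewrite mem_iota.
  case: s; [case/and3P: halft | case/and3P: halff] => /allP h1 /allP h2 _.
    by case: h; [apply: h1 | apply: h2].
  by case: h; [apply: h1 | apply: h2].
case/and3P; set P := half_types _ _ _ _ => uP /eqP sP /allP bP.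
transitivity (count_mem (val a) P).
  have -> : count_mem (val a) P = \sum_(z <- P) (z == val a).
    by rewrite -sum1_count [LHS]big_mkcond /=; apply: eq_bigr => z _; case: eqP.
  rewrite big_map /P /half_types big_flatten big_map big_filter big_seq_cond [RHS]big_seq_cond.
  apply: eq_big => [p|p /andP[pL _]].
    case: (boolP (p \in L)) => //= pL; rewrite /rsym /rhalf /=; congr (_ && _).
    by rewrite to_symbol_code // (column_lt None).
  have E sg : (pos (to_row p).1.1 s sg == inl a) = (pos p.1.1 s sg == val a).
    by rewrite pos_col to_symbol_code // (column_lt (Some (s, sg))).
  by rewrite /ind1 big_bool !big_cons big_nil /= addn0 !E.
rewrite count_uniq_mem //.
have sub : {subset P <= iota 0 t} by move=> z /bP; rewrite mem_iota.
have [_ ->] := uniq_min_size uP sub (eq_leq (etrans (size_iota 0 t) (esym sP))).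
by rewrite mem_iota /= ltn_ord.
Qed.
End CodedITD.

(* Nonzero (i, j) in Z_q^2 with round i, men j, i - j and women i + 2j, i - 2j; the infinite
   symbol [q - 1] stands for 0 and the finite type k for k + 1. *)
Definition prime_itd q : seq nat_row :=
  let s z := if z %% q == 0 then q.-1 else (z %% q).-1 in
  [seq (s z.2, s (z.1 + 2 * z.2), s (z.1 + (q - z.2)), s (z.1 + 2 * (q - z.2)), s z.1, 2 * z.2 < q)
  | z <- [seq (i, j) | i <- iota 0 q, j <- iota 0 q] & z != (0, 0)].

Lemma itd_4_1 : is_itd 4 1 (prime_itd 5). Proof. by vm_compute. Qed.

(* In F_4, [2] and [3] code the primitive elements. *)
Definition add4 u v := odd (u + v) + 2 * odd (u./2 + v./2).
Definition itd4 : seq nat_row :=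
  [seq (g, add4 y g, add4 (nth 0 [:: 0; 2; 3; 1] y) g, add4 (nth 0 [:: 0; 3; 1; 2] y) g, y, false)
  | y <- iota 0 4, g <- iota 0 4].

Lemma itd_4_0 : is_itd 4 0 itd4. Proof. by vm_compute. Qed.

Lemma itd_12_1 : is_itd 12 1 (prime_itd 13). Proof. by vm_compute. Qed.

(* [6 * a + b] codes the element [(a, b)] of [Z_2 x Z_6]. *)
Definition add12 u v := (u %/ 6 + v %/ 6) %% 2 * 6 + (u %% 6 + v %% 6) %% 6.
(** A difference matrix over Z_2 x Z_6: the zero map, two listed permutations and the identity,
    whose pairwise differences are again permutations, developed over [g]. The column [y] is the
    round. *)
Definition itd12 : seq nat_row :=
  [seq (g, add12 (nth 0 [:: 0; 7; 11; 5; 2; 6; 4; 10; 9; 8; 3; 1] y) g, add12 y g,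
        add12 (nth 0 [:: 0; 3; 9; 8; 5; 11; 10; 6; 4; 1; 7; 2] y) g, y, false)
  | y <- iota 0 12, g <- iota 0 12].

Lemma itd_12_0 : is_itd 12 0 itd12. Proof. by vm_compute. Qed.

(** A base block lists two men, two women and the round. Entries below 8 are translated by a group
    of order 8; larger ones are infinite symbols and stay fixed. *)
Definition develop (add : nat -> nat -> nat) (half : nat -> nat -> bool) (B : seq (seq nat)) : seq nat_row :=
  [seq (let f i := let z := nth 0 b i in if z < 8 then add z g else z in
        (f 0, f 2, f 1, f 3, f 4, half (nth 0 b 4) g)) | b <- B, g <- iota 0 8].

(* Found by computer. *)
Definition itd8_1 := develop (fun z g => (z + g) %% 8) (fun _ => odd)
  [:: [:: 8; 1; 1; 2; 4]; [:: 1; 8; 1; 1; 1]; [:: 1; 1; 5; 3; 7]; [:: 1; 5; 8; 4; 2];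
      [:: 1; 0; 2; 5; 0]; [:: 1; 2; 3; 0; 8]; [:: 1; 3; 0; 7; 4]; [:: 1; 4; 7; 8; 6];
      [:: 1; 7; 6; 2; 3]; [:: 1; 6; 4; 6; 5]].

Lemma itd_8_1 : is_itd 8 1 itd8_1. Proof. by vm_compute. Qed.

Definition add8 u v := odd (u + v) + 2 * odd (u./2 + v./2) + 4 * odd (u./2./2 + v./2./2).
(** The group is Z_2^3. The lowest bit separates the two men, and the two women, of the block with
    round 8; the middle bit does so for round 9. Hence translates by one coset of the corresponding
    subgroup of index 2 form a half. *)
Definition itd8_2 := develop add8 (fun r g => odd (if r == 8 then g else g./2))
  [:: [:: 8; 0; 6; 0; 3]; [:: 9; 0; 0; 3; 6]; [:: 0; 8; 6; 1; 7]; [:: 0; 9; 3; 7; 0];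
      [:: 0; 3; 8; 4; 4]; [:: 0; 0; 9; 5; 1]; [:: 0; 4; 1; 8; 6]; [:: 0; 1; 5; 9; 5];
      [:: 0; 5; 2; 3; 8]; [:: 0; 7; 4; 6; 9]; [:: 0; 6; 7; 2; 3]; [:: 0; 2; 0; 0; 2]].

Lemma itd_8_2 : is_itd 8 2 itd8_2. Proof. by vm_compute. Qed.

(** * Linear starters and the smallest design *)

Lemma sum_option (T : finType) (F : option T -> nat) :
  \sum_u F u = F None + \sum_a F (Some a).
Proof.
rewrite (bigD1 None) //=; congr (_ + _).
rewrite (reindex_omap Some id) => [|[]//]; apply: eq_bigl => a.
by rewrite eqxx.
Qed.

(** One extra point sent to [u0] makes [f] a bijection. *)
Lemma sum_inj_neq (T U : finType) (f : T -> U) u0 y : injective f ->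
  (forall t, f t != u0) -> #|T|.+1 = #|U| -> \sum_t (f t == y) = (y != u0).
Proof.
move=> finj fu0 cTU; pose g o := if o is Some t then f t else u0.
have ginj : injective g.
  case=> [t|] [t'|] //= => [/finj->//|e|e].
    by have := fu0 t; rewrite e eqxx.
  by have := fu0 t'; rewrite -e eqxx.
have := sum_inj1 y ginj (etrans (card_option T) cTU).
rewrite sum_option /= eq_sym; case: (y == u0) => [[]|] //.
Qed.

Section LinearStarter.
Variable p : nat.
Notation q := (p.+1).
Hypothesis q6 : coprime q 6.
Local Open Scope ring_scope.

Lemma mulrn_inj k : coprime q k -> injective (fun v : 'I_q => v *+ k).
Proof.
move=> qk u v /eqP; rewrite -subr_eq0 -mulrnBl -[X in _ -> X]/(u = v).
move: (u - v) (subr0_eq (x := u) (y := v)) => w uv; rewrite Zp_mulrn => /eqP/(congr1 val) /= E.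
apply/uv/val_inj; case: (posnP w) => // w0.
have : (q %| w * k)%N by rewrite /dvdn E.
by rewrite Gauss_dvdl // gtnNdvd.
Qed.

Definition sgn (sg : bool) (v : 'I_q) := if sg then v else - v.
Definition element (i : 'I_(p./2)) : 'I_q := inZp i.+1.

Lemma double_half : (2 * p./2 = p)%N.
Proof.
rewrite mul2n even_halfK //; move: q6; rewrite (coprimeMr q 2 3) coprimen2 => /andP[/= op _].
exact: op.
Qed.

Lemma val_element i : val (element i) = i.+1.
Proof.
rewrite /= modn_small //.
by have := ltn_ord i; have := double_half; lia.
Qed.

Lemma val_element_opp i : val (- element i) = (q - i.+1)%N.
Proof.
rewrite -[LHS]/((q - val (element i)) %% q)%N val_element modn_small //.
by have := ltn_ord i; lia.
Qed.

Lemma val_sgn sg i : val (sgn sg (element i)) = if sg then i.+1 else (q - i.+1)%N.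
Proof. by case: sg; [apply: val_element | apply: val_element_opp]. Qed.

Lemma sum_elements k y : coprime q k ->
  (\sum_(i < p./2) \sum_(sg : bool) (sgn sg (element i) *+ k == y) = (y != 0%R))%N.
Proof.
move=> qk; rewrite pair_big /=.
apply: (sum_inj_neq (f := fun e : 'I_(p./2) * bool => sgn e.2 (element e.1) *+ k)).
- move=> [i b] [j c] /= /(mulrn_inj qk) /(congr1 val); rewrite !val_sgn.
  have := ltn_ord i; have := ltn_ord j; have := double_half.
  by case: b; case: c => ? ? ? ?; congr (_, _); try apply: val_inj => /=; lia.
- move=> [i b] /=; apply/eqP => E.
  have /(mulrn_inj qk)/(congr1 val) : sgn b (element i) *+ k = 0 *+ k by rewrite E mul0rn.
  by rewrite val_sgn /=; have := ltn_ord i; have := double_half; case: (b); lia.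
- by rewrite card_prod card_ord card_bool card_ord; have := double_half; lia.
Qed.

Definition linear_base (i : 'I_(p./2)) : quad 'I_q :=
  (element i, element i *+ 2, - element i, - (element i *+ 2)).

Lemma coprime_q k : k \in [:: 1; 2; 3; 4] -> coprime q k.
Proof.
have [q2 q3] : coprime q 2 /\ coprime q 3 by apply/andP; rewrite -coprimeMr.
rewrite !inE => /or4P[] /eqP-> //; first exact: coprimen1.
by rewrite (coprimeMr q 2 2) q2.
Qed.

Lemma linear_cosets : cosets id (fun _ : 'I_q => tt) (fun _ v => v).
Proof. by split=> // -[]. Qed.

(** Men are ±d and women ±2d, and the differences are ±d, ±3d, ±2d, ±4d for the four relations in
    order. Multiplication by 1, 2, 3, 4 is injective modulo [q], so each list runs once through the
    nonzero residues. *)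
Lemma linear_starter : starter id linear_base.
Proof.
split=> [s|r] y.
- rewrite -(@sum_elements (if s then 1 else 2) y); last by apply: coprime_q; case: s.
  apply: eq_bigr => i _; apply: eq_bigr => sg _.
  by case: s sg => [] []; rewrite /= ?mulNrn.
pose k := match r with PartnerMW => 1 | OppMW => 3 | OppMM => 2 | OppWW => 4 end%N.
rewrite -(@sum_elements k y); last by apply: coprime_q; rewrite /k; case: (r).
apply: eq_bigr => i _; rewrite !big_bool /= /sgn mulNrn /k.
case: r {k} => /=.
- by rewrite mulr1n mulr2n opprD !addrK.
- by rewrite opprK -opprD -mulrSr addnC.
- by rewrite opprK -opprD -mulr2n addnC.
- by rewrite opprK -opprD -mulrnDr addnC.
Qed.
End LinearStarter.

Definition small_round (r : 'I_3) : seq (quad 'I_3) :=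
  let o k : 'I_3 := inord k in
  match val r with
  | 0 => [:: (o 0, o 1, o 1, o 2)]
  | 1 => [:: (o 0, o 2, o 2, o 1)]
  | _ => [:: (o 1, o 0, o 2, o 2)]
  end.
Definition small_short : seq (quad 'I_3) :=
  let o k : 'I_3 := inord k in [:: (o 1, o 1, o 2, o 0)].
Definition small_double (x : 'I_3) : 'I_3 := nth ord0 [:: ord0; inord 2; inord 1] x.

Lemma small_ifr : ifr set0 [set ord0] (fun _ => small_double) small_round small_short.
Proof.
have o0 : ord0 = inord 0 :> 'I_3 by apply: val_inj; rewrite /= inordK.
have E (a b : nat) : a < 3 -> b < 3 -> (inord a == inord b :> 'I_3) = (a == b).
  by move=> a3 b3; rewrite -val_eqE /= !inordK.
have I3 (P : 'I_3 -> Prop) : P (inord 0) -> P (inord 1) -> P (inord 2) -> forall x, P x.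
  move=> P0 P1 P2 x; have -> : x = inord x by rewrite inord_val.
  by case: x => -[|[|[|//]]].
have R0 : small_round (inord 0) = [:: (inord 0, inord 1, inord 1, inord 2)].
  by rewrite /small_round /= inordK.
have R1 : small_round (inord 1) = [:: (inord 0, inord 2, inord 2, inord 1)].
  by rewrite /small_round /= inordK.
have R2 : small_round (inord 2) = [:: (inord 1, inord 0, inord 2, inord 2)].
  by rewrite /small_round /= inordK.
have d0 : small_double (inord 0) = inord 0 by rewrite /small_double /= inordK //; apply: val_inj; rewrite /= inordK.
have d1 : small_double (inord 1) = inord 2 by rewrite /small_double /= inordK //; apply: val_inj; rewrite /= inordK.
have d2 : small_double (inord 2) = inord 1 by rewrite /small_double /= inordK //; apply: val_inj; rewrite /= inordK.
have sum3 (F : 'I_3 -> nat) : \sum_r F r = F (inord 0) + (F (inord 1) + F (inord 2)).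
  rewrite !big_ord_recl big_ord0 addn0.
  by congr (F _ + (F _ + F _)); apply: val_inj; rewrite /= inordK.
split.
- exact: sub0set.
- by move=> s; apply: (@I3 _); rewrite !(d0, d1, d2).
- by move=> s; apply: (@I3 _); rewrite ?d0 ?d1 ?d2 inE o0 !E //.
- case; apply: (@I3 _); apply: (@I3 _);
    rewrite inE /tot sum3 R0 R1 R2 !big_seq1 /target /ind !big_bool /= ?(d0, d1, d2) ?inE ?o0 !E //.
(* The lists name the man and the woman who sit out rounds 0, 1, 2. *)
- move=> s r _; exists (inord (nth 0 (if s then [:: 2; 1; 0] else [:: 0; 0; 1]) r)).
  move: r; apply: (@I3 _); rewrite ?R0 ?R1 ?R2 inordK //=; case: s => /=; apply: (@I3 _);
  by rewrite big_seq1 /ind1 big_bool /= !E //.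
- by move=> s r x; rewrite inE.
- by move=> s; apply: (@I3 _); rewrite inE big_seq1 /ind1 big_bool; case: s; rewrite /= !E //.
Qed.

Lemma FR_3_1 : IFR 3 0 1.
Proof. by have := IFR_intro small_ifr; rewrite card_ord cards0 cards1. Qed.

(** * From designs to tournaments *)

Section ToCMDRR.
Variables (N : nat) (A : {set 'I_N}) (dl : bool -> 'I_N -> 'I_N).
Variables (R : 'I_N -> seq (game N)) (Z : seq (game N)).
Hypothesis D : ifr set0 A dl R Z.

Definition spouses : {set 'I_N * 'I_N} := [set (x, x) | x in A].
Definition rounds := rcons [seq R r | r <- enum 'I_N] Z.
Definition games := flatten rounds.

Lemma sum_games F : \sum_(g <- games) F g = tot F R Z.
Proof.
by rewrite /games /rounds -cats1 flatten_cat big_cat /= cats0 big_flatten big_map big_enum.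
Qed.

Lemma ind_games r x y : \sum_(g <- games) ind r x y g = target A dl r x y.
Proof. by rewrite sum_games (ifr_rel D) inE. Qed.

Lemma ind_games0 r x y g : target A dl r x y = 0 -> g \in games -> ind r x y g = 0.
Proof.
rewrite -ind_games => /eqP; rewrite sum_nat_seq_eq0 => /allP E gG.
by apply/eqP; have := E g gG.
Qed.

(** The same-sex targets vanish on the diagonal, so nobody opposes himself. *)
Lemma games_valid g : g \in games -> valid_game g.
Proof.
move=> gG; rewrite /valid_game; apply/andP; split; apply/eqP => e.
  have := @ind_games0 OppMM (gm1 g) (gm1 g) g _ gG.
  by rewrite /target eqxx /ind big_bool /= -/(gm1 g) -/(gm2 g) -e eqxx => /(_ erefl).
have := @ind_games0 OppWW (gw1 g) (gw1 g) g _ gG.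
by rewrite /target eqxx /ind big_bool /= -/(gw1 g) -/(gw2 g) -e eqxx => /(_ erefl).
Qed.

(** A valid game realises a relation in at most one of the two ways, so the disjunctions in the
    counts split into the two summands of [ind]. *)
Lemma count_games (P Q : game N -> bool) F : (forall g, g \in games -> ~~ (P g && Q g)) ->
  (forall g, F g = P g + Q g) -> count (fun g => P g || Q g) games = \sum_(g <- games) F g.
Proof.
move=> PQ FE; rewrite -sum1_count big_mkcond /=; apply: eq_big_seq => g /PQ.
by rewrite FE; case: (P g); case: (Q g).
Qed.

Lemma partner_countE m w : partner_count games m w = target A dl PartnerMW m w.
Proof.
rewrite -ind_games; apply: count_games => [g|g]; last by rewrite /ind big_bool.
case/games_valid/andP => mm _; apply: contraNN mm => /andP[/andP[/eqP-> _] /andP[/eqP-> _]].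
exact: eqxx.
Qed.

Lemma opp_mw_countE m w : opp_mw_count games m w = target A dl OppMW m w.
Proof.
rewrite -ind_games; apply: count_games => [g|g]; last by rewrite /ind big_bool.
case/games_valid/andP => mm _; apply: contraNN mm => /andP[/andP[/eqP-> _] /andP[/eqP-> _]].
exact: eqxx.
Qed.

Lemma opp_men_countE m m' : opp_men_count games m m' = target A dl OppMM m m'.
Proof.
rewrite -ind_games; apply: count_games => [g|g]; last first.
  by rewrite /ind big_bool; congr (_ + nat_of_bool _); apply: andbC.
case/games_valid/andP => mm _; apply: contraNN mm => /andP[/andP[/eqP-> /eqP->] /andP[/eqP-> _]].
exact: eqxx.
Qed.

Lemma opp_women_countE m m' : opp_women_count games m m' = target A dl OppWW m m'.
Proof.
rewrite -ind_games; apply: count_games => [g|g]; last first.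
  by rewrite /ind big_bool; congr (_ + nat_of_bool _); apply: andbC.
case/games_valid/andP => _ mm; apply: contraNN mm => /andP[/andP[/eqP-> /eqP->] /andP[/eqP-> _]].
exact: eqxx.
Qed.

Lemma mem_spouses m w : ((m, w) \in spouses) = (m == w) && (m \in A).
Proof.
apply/imsetP/andP => [[x xA [-> ->]]|[/eqP<- mA]]; first by rewrite eqxx.
by exists m.
Qed.

Lemma spouse_man m : has_spouse_man spouses m = (m \in A).
Proof.
apply/existsP/idP => [[w]|mA]; first by rewrite mem_spouses => /andP[].
by exists m; rewrite mem_spouses eqxx.
Qed.

Lemma spouse_woman w : has_spouse_woman spouses w = (w \in A).
Proof.
apply/existsP/idP => [[m]|wA]; first by rewrite mem_spouses => /andP[/eqP->].
by exists w; rewrite mem_spouses eqxx.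
Qed.

Lemma target_same r x y : same_sex r -> x \in A -> y != x -> target A dl r x y = 1.
Proof.
move=> sr xA yx; have /eqP E : dl (rel_fst r) x == x by rewrite (ifr_fix D).
by rewrite /target sr E eq_sym (negbTE yx).
Qed.

Lemma target_double r x : same_sex r -> x \notin A -> exists y,
  [/\ y != x, y \notin A, target A dl r x y = 2 &
      forall z, z != x -> z != y -> target A dl r x z = 1].
Proof.
move=> sr xA; exists (dl (rel_fst r) x).
have ne : dl (rel_fst r) x != x by rewrite (ifr_fix D).
split=> //.
- by rewrite -(ifr_fix D (rel_fst r)) (ifr_inv D) eq_sym.
- by rewrite /target sr eq_sym ne eqxx.
- by move=> z zx zd; rewrite /target sr eq_sym zx eq_sym (negbTE zd).
Qed.

Lemma games_CMDRR : is_CMDRR #|A| spouses games.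
Proof.
split.
- split; [|split].
  + by move=> _ _ /imsetP[x _ ->] /imsetP[y _ ->] /= [] ->.
  + by rewrite card_imset // => x y [].
  + by apply/allP => g /games_valid.
- move=> g m w gG; rewrite mem_spouses => /andP[/eqP<- mA].
  (* Spouses in a common game would be partners or opponents in it, and both of their totals are
     0. *)
  have t0 r : same_sex r = false -> target A dl r m m = 0 by rewrite /target => ->; rewrite eqxx mA.
  have := ind_games0 (t0 PartnerMW erefl) gG; have := ind_games0 (t0 OppMW erefl) gG.
  rewrite /ind !big_bool /= -/(gm1 g) -/(gm2 g) -/(gw1 g) -/(gw2 g).
  move=> o p [mg wg]; move: o p mg wg; rewrite !inE ![m == _]eq_sym.
  by do 4 case: eqP => _.
- move=> m w; rewrite partner_countE opp_mw_countE mem_spouses /target /=.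
  by move=> /negbTE->.
- split=> x; rewrite ?spouse_man ?spouse_woman => xA y yx.
    by rewrite opp_men_countE target_same.
  by rewrite opp_women_countE target_same.
- split=> x; rewrite ?spouse_man ?spouse_woman => xA.
    have [y [yx yA t2 t1]] := @target_double OppMM x erefl xA.
    exists y; rewrite spouse_man opp_men_countE; split=> // z zx zy.
    by rewrite opp_men_countE t1.
  have [y [yx yA t2 t1]] := @target_double OppWW x erefl xA.
  exists y; rewrite spouse_woman opp_women_countE; split=> // z zx zy.
  by rewrite opp_women_countE t1.
Qed.

Definition round_players (s : bool) (L : seq (game N)) := if s then round_men L else round_women L.

Lemma count_round s L x : count_mem x (round_players s L) = \sum_(g <- L) ind1 s x g.
Proof.
elim: L => [|g L IH]; first by rewrite big_nil; case: s.
rewrite big_cons -IH /ind1 big_bool; by case: s {IH}; rewrite /= addnA.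
Qed.

Lemma round_uniq s L : (forall x, \sum_(g <- L) ind1 s x g <= 1) -> uniq (round_players s L).
Proof.
move=> le1; apply: count_mem_uniq => x.
by have := le1 x; rewrite -count_round -has_pred1 has_count; case: count => [|[]].
Qed.

Lemma rounds_valid : all (@valid_round N) rounds.
Proof.
have V (L : seq (game N)) : (forall s x, \sum_(g <- L) ind1 s x g <= 1) -> valid_round L.
  move=> le1; have := round_uniq (le1 true); have := round_uniq (le1 false).
  by rewrite /valid_round /round_players => -> ->.
rewrite all_rcons V => [|s x]; last by rewrite (leq_trans (ifr_short D s x)) ?leq_b1.
apply/allP => _ /mapP[r _ ->]; apply: V => s x.
have rC : r \notin (set0 : {set 'I_N}) by rewrite inE.
by have [b ->] := ifr_round D s rC; rewrite leq_b1.
Qed.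

Lemma round_full r : odd N -> full_round (R r).
Proof.
move=> oN; rewrite /full_round /players_in_round oN.
have card s : #|[set x | x \in round_players s (R r)]| = N.-1.
  have rC : r \notin (set0 : {set 'I_N}) by rewrite inE.
  have [b Hb] := ifr_round D s rC.
  rewrite -[N in RHS]card_ord -(cardC1 b); apply: eq_card => x.
  rewrite [LHS]inE [RHS]inE /= -has_pred1 has_count count_round Hb.
  by case: (x == b).
by rewrite (card true) (card false); case: N oN => //= n _; apply/eqP; lia.
Qed.

Lemma games_resolvable : odd N -> fully_resolvable games.
Proof.
move=> oN; exists rounds; split; [by [] | exact: rounds_valid |].
rewrite /rounds -cats1 count_cat /= addn0 count_map.
rewrite (eq_count (a2 := pred0)) => [|r]; last by rewrite /= round_full.
by rewrite count_pred0; case: full_round.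
Qed.
End ToCMDRR.

(** * The recursion *)

Definition FR n := IFR (3 * n) 0 n.

(** Two designs with consecutive hole sizes suffice: the first [k] of the [s] starter games take
    [lo.+1] infinite symbols and the others [lo], which realises every intermediate number of
    infinite players of the form 3 + 2j. *)
Lemma FR_recursion (G V : finZmodType) (T : finType) (pr : G -> V) (hd : G -> T) mk
    s (base : 'I_s -> quad G) t m lo k
    (rows0 rows1 : seq nat_row) n' :
  cosets pr hd mk -> starter pr base -> is_itd t lo rows0 -> is_itd t lo.+1 rows1 -> 0 < t -> t * #|T| = 3 * m ->
  IFR (3 * m + 3) 3 (m + 3) -> FR n' -> k <= s -> 3 * n' = 3 + 2 * (lo * s + k) ->
  FR (m * #|V| + n').
Proof.
move=> prP baseP itd0 itd1 t0 tH hole inf ks n'E.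
pose x (i : 'I_s) := if i < k then lo.+1 else lo.
pose rows (i : 'I_s) := [seq to_row t p | p <- if i < k then rows1 else rows0].
have rowsP i : itd (x i) (rows i).
  by rewrite /x /rows; case: ifP => _; apply: itd_of_seq.
have sumx : \sum_i x i = lo * s + k.
  transitivity (\sum_(i < s) (lo + (i < k))).
    by apply: eq_bigr => i _; rewrite /x; case: ifP; rewrite ?addn1 ?addn0.
  rewrite big_split /= sum_nat_const card_ord mulnC; congr (_ + _).
  transitivity (\sum_(i < s | i < k) 1).
    by rewrite [RHS]big_mkcond /=; apply: eq_bigr => i _; case: ifP.
  by rewrite (big_ord_narrow ks) sum1_card card_ord.
have F := @IFR_frame G V T pr hd mk _ base 'I_t (Ordinal t0) x rows 3 (m + 3) n' prP baseP rowsP.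
move: F; rewrite card_ord (card_cosets prP) sumx -n'E mulnA tH => /(_ hole inf).
by rewrite addnK /FR mulnDr mulnA [#|V| * m]mulnC.
Qed.

Lemma FR_starter (G V : finZmodType) (T : finType) (pr : G -> V) (hd : G -> T) mk
    s (base : 'I_s -> quad G) : cosets pr hd mk -> starter pr base -> #|T| = 3 ->
  FR #|V| /\ IFR (3 * #|V|) 3 (3 + #|V|.-1).
Proof.
move=> prP baseP T3; have := @IFR_starter _ _ _ _ _ _ _ _ 1 prP baseP.
by rewrite (card_cosets prP) T3 !muln1 => /(_ FR_3_1).
Qed.

Definition direct_pr p (y : 'I_3 * 'I_p.+1) : 'I_p.+1 := y.2.
Definition direct_hd p (y : 'I_3 * 'I_p.+1) : 'I_3 := y.1.

Lemma direct_cosets p : cosets (@direct_pr p) (@direct_hd p) pair.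
Proof. by split=> //; case. Qed.

Definition starters := [:: base5; base7; base9; base11; base13; base15; base17; base19; base23;
  base31; base39].
(** Each game uses two of the 3(n - 1) points outside the hole, so this recovers n - 1. *)
Definition starter_size (B : seq (quad (nat * nat))) := 2 * size B %/ 3.

Lemma starters_ok : all (fun B => is_starter 2 (starter_size B) (fun z => z.2 != 0) B && (2 * size B == 3 * starter_size B)) starters.
Proof. by vm_compute. Qed.

Definition starter_orders := [seq (starter_size B).+1 | B <- starters].

Lemma has_starter n : n \in starter_orders -> exists s (base : 'I_s -> quad ('I_3 * 'I_n.-1.+1)),
  [/\ starter (@direct_pr n.-1) base, n = n.-1.+1 & 2 * s = 3 * n.-1].
Proof.
case/mapP => B BS ->; have /andP[BP /eqP sB] := allP starters_ok B BS.
by do 2 eexists; split; [apply: starter_of_seq BP _ | | exact: sB].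
Qed.

Lemma hole15 : IFR (3 * 4 + 3) 3 (4 + 3).
Proof.
have [//|s [base [baseP _ _]]] := @has_starter 5.
by have [] := FR_starter (direct_cosets 4) baseP (card_ord 3); rewrite card_ord.
Qed.

Lemma hole27 : IFR (3 * 8 + 3) 3 (8 + 3).
Proof.
have [//|s [base [baseP _ _]]] := @has_starter 9.
by have [] := FR_starter (direct_cosets 8) baseP (card_ord 3); rewrite card_ord.
Qed.

Lemma FR_T4 n n' : n \in starter_orders -> FR n' -> odd n' -> n' <= n -> FR (4 * n + n').
Proof.
case/has_starter => s [base [baseP nE sE]] F n'1 n'n.
rewrite nE -[n.-1.+1]card_ord.
(* For odd [n'], 3n' = 3 + 2k gives [k], and k <= s = 3(n - 1)/2 amounts to n' <= n. *)
apply: (FR_recursion (t := 4) (lo := 0) (k := 3 * n'./2) (s := s) (direct_cosets _) baseP itd_4_0 itd_4_1) => //.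
- by rewrite card_ord.
- exact: hole15.
- lia.
- lia.
Qed.

Lemma FR_T8 n n' : n \in starter_orders -> FR n' -> odd n' -> n <= n' <= 2 * n - 1 -> FR (8 * n + n').
Proof.
case/has_starter => s [base [baseP nE sE]] F n'1 n'n.
rewrite nE -[n.-1.+1]card_ord.
(* Each game has one or two infinite symbols, so 3(n' - 1)/2 must lie between [s] and 2s; these are
   the two bounds on [n']. *)
apply: (FR_recursion (t := 8) (lo := 1) (k := 3 * n'./2 - s) (s := s) (direct_cosets _) baseP itd_8_1 itd_8_2) => //.
- by rewrite card_ord.
- exact: hole27.
- lia.
- lia.
Qed.

Lemma FR_J q n' : coprime q 6 -> FR n' -> odd n' -> 3 * n' <= q + 2 -> FR (4 * q + n').
Proof.
case: q => // p q6 F n'1 n'q; have p2 := double_half q6.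
rewrite -[p.+1]card_ord.
apply: (FR_recursion (t := 12) (lo := 0) (k := 3 * n'./2) (linear_cosets p) (linear_starter q6) itd_12_0 itd_12_1) => //.
- by rewrite card_unit.
- exact: hole15.
- lia.
- lia.
Qed.

(* For [n = 27] the group is [Z_9 x Z_9], with hole subgroup [3 Z_9 x 0]. *)
Definition pr27 (y : 'I_9 * 'I_9) : 'I_3 * 'I_9 := (inZp y.1, y.2).
Definition hd27 (y : 'I_9 * 'I_9) : 'I_3 := inord (y.1 %/ 3).
Definition mk27 (h : 'I_3) (v : 'I_3 * 'I_9) : 'I_9 * 'I_9 := (inord (3 * h + v.1), v.2).

Lemma cosets27 : cosets pr27 hd27 mk27.
Proof.
have lt9 (h u : 'I_3) : 3 * h + u < 9 by have := ltn_ord h; have := ltn_ord u; lia.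
split.
- move=> [a b] [c d]; congr (_, _); apply: val_inj => /=.
  have := ltn_ord a; have := ltn_ord c; lia.
- move=> h [u v]; congr (_, _); apply: val_inj; rewrite /= inordK //.
  have := ltn_ord u; lia.
- move=> h [u v]; rewrite /hd27 /mk27 /= (inordK (lt9 h u)) mulnC divnMDl //.
  by rewrite divn_small ?ltn_ord // addn0 inord_val.
move=> [a b]; rewrite /hd27 /mk27 /=; congr (_, _).
rewrite inordK ?ltn_divLR ?ltn_ord // mulnC -divn_eq; exact: inord_val.
Qed.

Lemma starter27 : is_starter 8 8 (fun z => (z.1 %% 3 != 0) || (z.2 != 0)) base27.
Proof. by vm_compute. Qed.

Lemma FR_27 : FR 27.
Proof.
have [|F _] := FR_starter cosets27 (starter_of_seq starter27 _) (card_ord 3).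
  by move=> [a b] /=; rewrite -negb_and.
by move: F; rewrite card_prod !card_ord.
Qed.

(** The alternatives are a direct starter and the hypotheses of [FR_T4], [FR_T8] and [FR_J]. The
    remainder [r] may be 1, by [FR_3_1], but not 3. *)
Definition covered n :=
  [|| n \in 27 :: starter_orders,
      has (fun m => let r := n - 4 * m in [&& 4 * m < n, odd r, r != 3 & r <= m]) starter_orders,
      has (fun m => let r := n - 8 * m in [&& 8 * m < n, odd r, r != 3 & m <= r <= 2 * m - 1]) starter_orders
    | has (fun q => let r := n - 4 * q in [&& odd q, q %% 3 != 0, 4 * q < n, odd r, r != 3 & 3 * r <= q + 2])
        (iota 5 60)].

Lemma covered_small : all (fun n => odd n ==> covered n) (iota 5 260).
Proof. by vm_compute. Qed.

Lemma coprime6 q : odd q -> q %% 3 != 0 -> coprime q 6.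
Proof.
move=> oq q3; rewrite (coprimeMr q 2 3) coprimen2 oq coprime_sym prime_coprime //.
Qed.

(** Consecutive integers congruent to 1 or 5 modulo 6 differ by at most 4; [d] is the distance from
    the residue [r] to the next one. *)
Lemma exists_coprime6 a : exists2 q, a <= q <= a + 3 & coprime q 6.
Proof.
have [r [k [-> r6]]] : exists r k, a = 6 * k + r /\ r < 6.
  by exists (a %% 6), (a %/ 6); rewrite mulnC -divn_eq ltn_mod.
pose d := nth 0 [:: 1; 0; 3; 2; 1; 0] r.
exists (6 * k + r + d).
  by rewrite leq_addr leq_add2l /d; case: r r6 {d} => [|[|[|[|[|[|]]]]]].
apply: coprime6; rewrite /d; first by case: r r6 {d} => [|[|[|[|[|[|]]]]]] //= _; lia.
by case: r r6 {d} => [|[|[|[|[|[|]]]]]] //= _; lia.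
Qed.

Lemma FR_odd n : odd n -> 5 <= n -> FR n.
Proof.
elim/ltn_ind: n => n IH on n5.
have IH' r : r < n -> odd r -> r != 3 -> FR r.
  by move=> rn; case: r rn => [//|[_ _ _|[//|[//|[//|r]]]]]; [apply: FR_3_1 | move=> rn orr _; apply: IH].
have [n265|n265] := ltnP n 265.
  have : covered n.
    have /allP/(_ n) := covered_small; rewrite mem_iota n5 on /=; apply; lia.
  case/or4P.
  - rewrite inE => /predU1P[->|nS]; first exact: FR_27.
    have [s [base [baseP nE _]]] := has_starter nS.
    by rewrite nE; have [] := FR_starter (direct_cosets _) baseP (card_ord 3); rewrite card_ord.
  - case/hasP => m mS /and4P[mn orr r3 rm].
    by rewrite -(subnKC (ltnW mn)); apply: FR_T4 => //; apply: IH' => //; lia.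
  - case/hasP => m mS /and4P[mn orr r3 rm].
    by rewrite -(subnKC (ltnW mn)); apply: FR_T8 => //; apply: IH' => //; lia.
  case/hasP => q _ /and5P[oq q3 mn orr /andP[r3 rq]].
  by rewrite -(subnKC (ltnW mn)); apply: FR_J => //; [apply: coprime6 | apply: IH' => //; lia].
(* With n' = n - 4q, the condition 3n' <= q + 2 reads 13q >= 3n - 2, and the quotient is (3n - 2)/13
   rounded up. *)
have [q /andP[aq qa] q6] := exists_coprime6 ((3 * n + 10) %/ 13).
have q1 : 13 * q >= 3 * n - 2 by lia.
(* Here n >= 265 is used: about n/13 remains after 4q, even if [q] exceeds the quotient by 3, so n'
   >= 5. *)
have q2 : 4 * q + 5 <= n by lia.
rewrite -(subnKC (_ : 4 * q <= n)); last lia.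
apply: FR_J => //; [apply: IH'; lia | lia | lia].
Qed.

Theorem theorem8 (n : nat) :
  odd n -> 5 <= n ->
  exists (S : {set 'I_(3 * n) * 'I_(3 * n)}) (G : seq (game (3 * n))),
    is_CMDRR n S G /\ fully_resolvable G.
Proof.
move=> on n5; have [A [dl [R [Z [D cA]]]]] := FR_odd on n5 (card_ord _) (cards0 _).
exists (spouses A), (games R Z); split.
  by have := games_CMDRR D; rewrite cA.
by apply: (games_resolvable D); rewrite oddM.
Qed.
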